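(* Let $d=2$ and let $\mu$ be a probability measure on the power set of $\mathcal{E}=\{e_1,e_2,-e_1,-e_2\}$. Suppose that $\mu(\{A: e\in A\})>0$ for each $e\in\mathcal{E}$, and that $\mu(\{A: A\cap\{e_2,-e_1\}\neq\emptyset\})=1$ and $\mu(\{A: A\cap\{-e_2,e_1\}\neq\emptyset\})=1$. Let $x\in\mathbb{Z}^2$. Then: (a) $\nu$-almost surely one of the following occurs: (i) $\mathcal{B}_x$ is finite; (ii) $\mathcal{B}_x=\mathbb{Z}^2$; (iii) there exists a decreasing upper blocking function $W:\mathbb{Z}\to\mathbb{Z}$ such that $\mathcal{B}_x=W_{\le}$; (iv) there exists a decreasing lower blocking function $W:\mathbb{Z}\to\mathbb{Z}$ such that $\mathcal{B}_x=W_{\ge}$. (b) At most one of (ii), (iii), (iv) can have positive probability. (c) $\nu$-almost surely, for $x,y\in\mathbb{Z}^2$, if $|\mathcal{B}_x|=|\mathcal{B}_y|=\infty$ then $|\mathcal{B}_x\cap\mathcal{B}_y|=\infty$.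
   Context: Let $e_1,e_2$ be the standard basis of $\mathbb{Z}^2$, and write $x=(x^{[1]},x^{[2]})$. The environment $\mathcal{G}=(\mathcal{G}_x)_{x\in\mathbb{Z}^2}$ is a random element of $\mathcal{P}^{\mathbb{Z}^2}$, where $\mathcal{P}$ is the power set of $\mathcal{E}$, with law the product measure $\nu=\mu^{\otimes\mathbb{Z}^2}$ (so the $\mathcal{G}_x$ are i.i.d. with law $\mu$). Write $x\to y$ if there are $n\ge 0$ and $x=x_0,x_1,\dots,x_n=y$ with $x_{i+1}-x_i\in\mathcal{G}_{x_i}$ for $0\le i<n$ (such a path is called open). Let $\mathcal{B}_y=\{x\in\mathbb{Z}^2: x\to y\}$. For $w:\mathbb{Z}\to\mathbb{Z}$ let $w_\le=\{y: y^{[2]}\le w(y^{[1]})\}$, $w_>=\{y: y^{[2]}>w(y^{[1]})\}$, and define $w_\ge$, $w_<$ analogously. $w$ is an upper blocking function for $\mathcal{G}$ if there is no open path in $\mathcal{G}$ from a point of $w_>$ to a point of $w_\le$; it is a lower blocking function if there is no open path from $w_<$ to $w_\ge$. ''Decreasing'' means non-increasing: $W(n+1)\le W(n)$ for all $n$. *)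

(* Defs.v *)
From HB Require Import structures.
From mathcomp Require Import all_boot all_order all_algebra.
From mathcomp Require Import all_classical all_reals all_analysis.

Set Implicit Arguments.
Unset Strict Implicit.
Unset Printing Implicit Defensive.

Import Order.TTheory GRing.Theory Num.Theory.
Local Open Scope classical_set_scope.
Local Open Scope ring_scope.

Notation Z2 := (int * int)%type.

Definition e1 : Z2 := (1, 0).
Definition e2 : Z2 := (0, 1).

Definition steps : seq Z2 := [:: e1; e2; - e1; - e2].

(* [seq_sub steps] is the finite subtype of Z2 whose elements are those of
   [steps], so this is literally the power set of {e1, e2, -e1, -e2}. *)
Definition powE : Type := {set seq_sub steps}.

HB.instance Definition _ := Finite.on powE.
HB.instance Definition _ := isPointed.Build powE finset.set0.
HB.instance Definition _ := @isMeasurable.Build default_measure_display powE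
  discrete_measurable discrete_measurable0
  discrete_measurableC discrete_measurableU.

Definition vec (A : powE) : set Z2 := [set ssval e | e in [set` A]].

Definition cylinders : set (set (Z2 -> powE)) :=
  [set [set G | B (G z)] | z in [set: Z2] & B in [set: set powE]].

(* The product sigma-algebra is generated by the one-site cylinders. *)
Definition env := g_sigma_algebraType cylinders.

(* mu^{(x) Z^2} is the only probability on [env] satisfying this. *)
Definition is_product_measure (R : realType) (mu : probability powE R)
    (nu : probability env R) :=
  forall (s : seq Z2) (B : Z2 -> set powE), uniq s ->
    nu [set G | forall z, z \in s -> B z (G z)]
    = (\prod_(z <- s) mu (B z))%E.

Definition open_path (G : env) (n : nat) (p : nat -> Z2) :=
  forall i, (i < n)%N -> vec (G (p i)) (p i.+1 - p i).

Definition reaches (G : env) (x y : Z2) :=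
  exists n p, [/\ p 0%N = x, p n = y & open_path G n p].

Definition Bset (G : env) (y : Z2) : set Z2 := [set x | reaches G x y].

Definition region_le (w : int -> int) : set Z2 := [set y | y.2 <= w y.1].
Definition region_lt (w : int -> int) : set Z2 := [set y | y.2 < w y.1].
Definition region_ge (w : int -> int) : set Z2 := [set y | w y.1 <= y.2].
Definition region_gt (w : int -> int) : set Z2 := [set y | w y.1 < y.2].

Definition upper_blocking (G : env) (w : int -> int) :=
  forall y z, region_gt w y -> region_le w z -> ~ reaches G y z.

Definition lower_blocking (G : env) (w : int -> int) :=
  forall y z, region_lt w y -> region_ge w z -> ~ reaches G y z.

Definition decreasingZ (w : int -> int) := forall n, w (n + 1) <= w n.

Definition finite_event (x : Z2) : set env :=
  [set G | finite_set (Bset G x)].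

Definition full_event (x : Z2) : set env := [set G | Bset G x = [set: Z2]].

Definition upper_event (x : Z2) : set env :=
  [set G | exists W, [/\ decreasingZ W, upper_blocking G W
                       & Bset G x = region_le W]].

Definition lower_event (x : Z2) : set env :=
  [set G | exists W, [/\ decreasingZ W, lower_blocking G W
                       & Bset G x = region_ge W]].

(* The three events compared in terms of their probabilities are measurable, so
   that [nu] takes its genuine value on them. *)

Lemma measurable_ex (d : measure_display) (T : measurableType d)
    (I : countType) (F : I -> set T) :
  (forall i, measurable (F i)) -> measurable [set t | exists i, F i t].
Proof.
move=> mF; have -> : [set t | exists i, F i t] = \bigcup_i F i.
  by apply/seteqP; split=> t; [move=> [i Fi]; exists i | move=> [i _ Fi]; exists i].
exact: countable_bigcupT_measurable.
Qed.

Lemma measurable_all (d : measure_display) (T : measurableType d)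
    (I : countType) (F : I -> set T) :
  (forall i, measurable (F i)) -> measurable [set t | forall i, F i t].
Proof.
move=> mF; have -> : [set t | forall i, F i t] = ~` [set t | exists i, ~ F i t].
  apply/seteqP; split=> t /= Ft; first by move=> [i]; apply; exact: Ft.
  by move=> i; apply: contrapT => nF; apply: Ft; exists i.
by apply: measurableC; apply: (@measurable_ex _ _ _ (fun i => ~` F i)) => i;
   exact: measurableC.
Qed.

Lemma measurable_const_prop (d : measure_display) (T : measurableType d)
    (P : Prop) : measurable [set _ : T | P].
Proof.
have [p|np] := pselect P.
  have -> : [set _ : T | P] = setT by apply/seteqP; split.
  exact: measurableT.
have -> : [set _ : T | P] = set0 by apply/seteqP; split.
exact: measurable0.
Qed.

Lemma measurable_imp (d : measure_display) (T : measurableType d)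
    (A B : set T) :
  measurable A -> measurable B -> measurable [set t | A t -> B t].
Proof.
move=> mA mB; have -> : [set t | A t -> B t] = ~` A `|` B.
  apply/seteqP; split=> t /=; last by move=> [nA /nA|].
  by move=> h; have [/h|] := pselect (A t); [right | left].
by apply: measurableU => //; exact: measurableC.
Qed.

Lemma measurable_step (x y : Z2) :
  measurable [set G : env | vec (G x) (y - x)].
Proof.
apply: sub_sigma_algebra; exists x => //.
by exists [set A | vec A (y - x)].
Qed.

Fixpoint reaches_in (n : nat) (x y : Z2) : set env :=
  if n is m.+1 then [set G | exists z, vec (G x) (z - x) /\ reaches_in m z y G]
  else [set _ | x = y].

Lemma reaches_inE (x y : Z2) :
  [set G : env | reaches G x y] = [set G | exists n, reaches_in n x y G].
Proof.
apply/seteqP; split=> G /=.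
  move=> [n [p [p0 pn op]]]; exists n.
  elim: n x p p0 pn op => [x p <- <-|n IH x p p0 pn op] //=.
  exists (p 1%N); split; first by rewrite -p0; exact: op.
  apply: (IH _ (fun k => p k.+1)) => // i ltin; exact: op.
move=> [n]; elim: n x => [x /= ->|n IH x [z [Gz /IH [m [p [p0 pm op]]]]]].
  by exists 0%N, (fun=> y).
exists m.+1, (fun k => if k is j.+1 then p j else x); split=> // -[_|i /op //].
by rewrite p0.
Qed.

Lemma measurable_reaches (x y : Z2) : measurable [set G : env | reaches G x y].
Proof.
rewrite reaches_inE; apply: measurable_ex => n.
elim: n x => [|n IH] x /=; first exact: measurable_const_prop.
apply: measurable_ex => z.
exact: measurableI (measurable_step x z) (IH z).
Qed.

Lemma reaches_trans (G : env) (x y z : Z2) :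
  reaches G x y -> reaches G y z -> reaches G x z.
Proof.
have E u v : reaches G u v = exists n, reaches_in n u v G.
  by have := reaches_inE u v => /(congr1 (fun A => A G)).
rewrite !E => -[n]; elim: n x => [x /= -> //|n IH x [w [Gw /IH h]]] /h [m hm].
by exists m.+1, w.
Qed.

Lemma measurable_full_event (x : Z2) : measurable (full_event x).
Proof.
rewrite (_ : full_event x = [set G | forall y, reaches G y x]).
  by apply: measurable_all => y; exact: measurable_reaches.
apply/seteqP; split=> G.
  by move=> /= BT y; have : Bset G x y by rewrite BT.
by move=> h; apply/seteqP; split=> // y _; exact: h.
Qed.

Lemma measurable_upper_event (x : Z2) : measurable (upper_event x).
Proof.
rewrite (_ : upper_event x = [set G |
  (forall i, exists m : int, forall j : int,
     (reaches G (i, j) x -> j <= m) /\ (j <= m -> reaches G (i, j) x)) /\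
  (forall ij : Z2, reaches G (ij.1 + 1, ij.2) x -> reaches G ij x)]).
  apply: measurableI; apply: measurable_all => i; last first.
    by apply: measurable_imp; exact: measurable_reaches.
  apply: measurable_ex => m; apply: measurable_all => j.
  have mjm : measurable [set _ : env | j <= m] by exact: measurable_const_prop.
  apply: measurableI.
    exact: (measurable_imp (measurable_reaches (i, j) x) mjm).
  exact: (measurable_imp mjm (measurable_reaches (i, j) x)).
apply/seteqP; split=> G /=.
  move=> [W [Wd _ BW]].
  have BE y : reaches G y x = (y.2 <= W y.1) :> Prop.
    by have := congr1 (fun A => A y) BW.
  split=> [i|[i j]]; first by exists (W i) => j; rewrite BE.
  by rewrite !BE /= => jW; apply: le_trans (Wd i).
move=> [/choice [W hW] hd].
have BW : Bset G x = region_le W.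
  by apply/seteqP; split=> -[i j]; have [h1 h2] := hW i j.
exists W; split=> // [i|y z gy lz yz].
  by apply: (hW i _).1; apply: hd; apply: (hW (i + 1) _).2.
have : Bset G x y.
  by apply: reaches_trans yz _; change (Bset G x z); rewrite BW.
by rewrite BW /region_le /= leNgt; rewrite /region_gt /= in gy; rewrite gy.
Qed.

Lemma measurable_lower_event (x : Z2) : measurable (lower_event x).
Proof.
rewrite (_ : lower_event x = [set G |
  (forall i, exists m : int, forall j : int,
     (reaches G (i, j) x -> m <= j) /\ (m <= j -> reaches G (i, j) x)) /\
  (forall ij : Z2, reaches G ij x -> reaches G (ij.1 + 1, ij.2) x)]).
  apply: measurableI; apply: measurable_all => i; last first.
    by apply: measurable_imp; exact: measurable_reaches.
  apply: measurable_ex => m; apply: measurable_all => j.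
  have mjm : measurable [set _ : env | m <= j] by exact: measurable_const_prop.
  apply: measurableI.
    exact: (measurable_imp (measurable_reaches (i, j) x) mjm).
  exact: (measurable_imp mjm (measurable_reaches (i, j) x)).
apply/seteqP; split=> G /=.
  move=> [W [Wd _ BW]].
  have BE y : reaches G y x = (W y.1 <= y.2) :> Prop.
    by have := congr1 (fun A => A y) BW.
  split=> [i|[i j]]; first by exists (W i) => j; rewrite BE.
  by rewrite !BE /=; apply: le_trans (Wd i).
move=> [/choice [W hW] hd].
have BW : Bset G x = region_ge W.
  by apply/seteqP; split=> -[i j]; have [h1 h2] := hW i j.
exists W; split=> // [i|y z gy lz yz].
  by apply: (hW (i + 1) _).1; apply: (hd (i, W i)); apply: (hW i _).2.
have : Bset G x y.
  by apply: reaches_trans yz _; change (Bset G x z); rewrite BW.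
by rewrite BW /region_ge /= leNgt; rewrite /region_lt /= in gy; rewrite gy.
Qed.

(* Main.v *)
(** The complement K of B_x is closed under open steps, so almost surely each
    point of K has an N or W neighbour in K and an S or E neighbour in K.  As
    B_x is connected, it lies in the down-closure of K if x does, and misses it
    otherwise; likewise for the up-closure.  If x lies in neither closure, K is
    both a down-set and an up-set, hence empty.  If x lies in exactly one, K is
    an up-set or a down-set meeting every column properly, which gives W.  If x
    lies in both, pick points of K above and below x: their NW paths inside K
    meet, and so do their SE paths, and the resulting loop encloses B_x.

    Two NW paths meet because, started on a common diagonal, the upper one
    preferring W and the lower one preferring N, their distance is a lazy random
    walk on the naturals with nonpositive drift.  The probability of not having
    met decreases to a bounded harmonic function vanishing at 0, i.e. to 0.

    Any two of the events (ii), (iii), (iv), one at x and the other at x - (0,n)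
    with n >= 0, are incompatible, whereas the shift is mixing: this gives (b),
    and with translation invariance (c). *)

From HB Require Import structures.
Require Import Defs.
From mathcomp Require Import all_boot all_order all_algebra.
From mathcomp Require Import all_classical all_reals all_analysis.
From mathcomp Require Import zify ring lra.

Set Implicit Arguments.
Unset Strict Implicit.
Unset Printing Implicit Defensive.

Import Order.TTheory GRing.Theory Num.Theory.
Import numFieldNormedType.Exports.
Local Open Scope classical_set_scope.
Local Open Scope ring_scope.

(** * Chains in the complement *)

(* [s = true] stands for the directions W, N and the usual order of the
   integers, [s = false] for E, S and the reverse order; the half-turn exchanges
   the two cases. *)
Definition sg (s : bool) : int := if s then 1 else -1.
Definition les (s : bool) (i j : int) := if s then i <= j else j <= i.

(** Only membership in [K] is recorded, not openness of the steps, so that a chain read backwards is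
    a chain of the opposite orientation. *)
Inductive chain (K : set Z2) (s : bool) : Z2 -> Z2 -> Prop :=
| chain_nil p : K p -> chain K s p p
| chain_horiz p z : K p -> chain K s (p.1 - sg s, p.2) z -> chain K s p z
| chain_vert p z : K p -> chain K s (p.1, p.2 + sg s) z -> chain K s p z.

Lemma chain_trans K s p q r : chain K s p q -> chain K s q r -> chain K s p r.
Proof.
elim=> // {}p z Kp _ IH zr; first exact: chain_horiz (IH zr).
exact: chain_vert (IH zr).
Qed.

Lemma chain_start K s p z : chain K s p z -> K p.
Proof. by case. Qed.

Lemma chain_end K s p z : chain K s p z -> K z.
Proof. by elim. Qed.

Lemma chain_rev K s p z : chain K s p z -> chain K (~~ s) z p.
Proof.
elim=> [{}p|{}p {}z Kp pz zp|{}p {}z Kp pz zp]; first exact: chain_nil.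
  apply: chain_trans zp _; apply: chain_horiz; first exact: chain_start pz.
  rewrite (_ : (_, _) = p); first exact: chain_nil.
  by case: p s {pz Kp} => i j [] /=; congr (_, _); lia.
apply: chain_trans zp _; apply: chain_vert; first exact: chain_start pz.
rewrite (_ : (_, _) = p); first exact: chain_nil.
by case: p s {pz Kp} => i j [] /=; congr (_, _); lia.
Qed.

Lemma chain_mono K s p z :
  chain K s p z -> les s z.1 p.1 /\ les s p.2 z.2.
Proof. by case: s; elim=> [[i j]|[i j] {}z|[i j] {}z] /=; lia. Qed.

(** The chain cannot pass through [(i, j)], so it leaves row [j] by a vertical step before reaching
    column [i]; [q] is the endpoint of that step. *)
Lemma chain_exit_row K s p z i j : chain K s p z -> ~ K (i, j) ->
  p.2 = j -> les s i p.1 -> les s z.1 i ->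
  exists q, [/\ chain K s p q, chain K s q z, les s i q.1 & les s (j + sg s) q.2].
Proof.
move=> pz nK; elim: pz => [[a l] Kp|[a l] {}z Kp pz IH|[a l] {}z Kp pz IH] /=.
- move=> lj ia ai; case: nK; rewrite -lj; suff -> : i = a by [].
  by case: s ia ai => /=; lia.
- move=> lj ia zi; have [ai|nai] := eqVneq a i.
    by case: nK; rewrite -lj -ai.
  have [//||//|q [pq qz iq jq]] := IH; first by case: s ia {zi pz IH} => /=; lia.
  by exists q; split=> //; exact: chain_horiz pq.
- move=> lj ia _; exists (a, l + sg s); split=> //=.
  + apply: chain_vert => //; apply: chain_nil.
    exact: chain_start pz.
  + by rewrite lj; case: s {ia pz IH} => /=.
Qed.

Lemma chain_exit_col K s p z i j : chain K s p z -> ~ K (i, j) ->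
  p.1 = i -> les s p.2 j -> les s j z.2 ->
  exists q, [/\ chain K s p q, chain K s q z, les s q.1 (i - sg s) & les s q.2 j].
Proof.
move=> pz nK; elim: pz => [[l a] Kp|[l a] {}z Kp pz IH|[l a] {}z Kp pz IH] /=.
- move=> li ja aj; case: nK; rewrite -li; suff -> : j = a by [].
  by case: s ja aj => /=; lia.
- move=> li ja _; exists (l - sg s, a); split=> //=.
  + apply: chain_horiz => //; apply: chain_nil.
    exact: chain_start pz.
  + by rewrite li; case: s {ja pz IH} => /=.
- move=> li ja zj; have [aj|naj] := eqVneq a j.
    by case: nK; rewrite -li -aj.
  have [//||//|q [pq qz iq jq]] := IH; first by case: s ja {zj pz IH} => /=; lia.
  by exists q; split=> //; exact: chain_vert pq.
Qed.

(** * Connected sets and the region enclosed by chains *)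

Definition adj (b c : Z2) :=
  exists s, c = (b.1 - sg s, b.2) \/ c = (b.1, b.2 + sg s).

(** Connectedness as an induction principle along adjacent points of [B]. *)
Definition connected_from (o : Z2) (B : set Z2) :=
  forall P : set Z2, P o ->
    (forall b c, P b -> B b -> B c -> adj b c -> P c) -> B `<=` P.

Definition lep s (b c : Z2) := les s b.1 c.1 /\ les s b.2 c.2.

Lemma les_refl s i : les s i i. Proof. by case: s => /=. Qed.
Lemma les_trans s i j k : les s i j -> les s j k -> les s i k.
Proof. by case: s => /=; lia. Qed.
Lemma lesN s i j : les (~~ s) i j = les s j i. Proof. by case: s. Qed.

(** By [chain_rev], these are the points on the monotone paths inside [K] from the corner [z false]
    to the corner [z true]. *)
Definition between K (z : bool -> Z2) : set Z2 :=
  [set p | forall s, chain K s p (z s)].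

Lemma between_chain K z s p q :
  between K z p -> chain K s p q -> chain K s q (z s) -> between K z q.
Proof.
move=> Gp pq qz t; have [->//|] := eqVneq t s.
move=> ts; have -> : t = ~~ s by case: t s ts {pq qz} => [] [].
apply: chain_trans (chain_rev pq) _; exact: Gp.
Qed.

(* A step of B leaving the region between two chains with common ends would have
   to cross one of them: follow it from the point witnessing the bound until it
   leaves the row (column) of the step. *)
Lemma trapped (K B : set Z2) (o : Z2) (z : bool -> Z2) :
  connected_from o B -> (forall b, B b -> ~ K b) ->
  (forall s, exists2 k, between K z k & lep s o k) ->
  B `<=` [set b | forall s, exists2 k, between K z k & lep s b k].
Proof.
move=> Bc BK o_in; apply: Bc => // b c Pb Bb _ [s bc] t.
have nKb := BK _ Bb.
have [p Gp bp] := Pb t; have [q Gq bq] := Pb (~~ t).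
have [[hz _] [_ vz]] := (chain_mono (Gq t), chain_mono (Gq (~~ t))).
have [cb|ncb] := pselect (lep t c b).
  by exists p => //; split; [apply: les_trans cb.1 bp.1|apply: les_trans cb.2 bp.2].
have [cp|ncp] := pselect (lep t c p); first by exists p.
case: b c p q => [i j] c [a l] [u v] in bc Bb nKb Gp bp Gq bq hz vz ncb ncp Pb *.
case: bc => cE; subst c; rewrite /lep /= in bp bq hz vz ncb ncp *.
- have st : s = ~~ t by case: t s {Pb Gp Gq} bp bq hz vz ncb ncp => [] [] /=; lia.
  subst s; have [|||r [pr rz r1 r2]] := chain_exit_col (Gp (~~ t)) nKb.
  + by case: t {Pb Gp Gq} bp bq hz vz ncb ncp => /=; lia.
  + by case: t {Pb Gp Gq} bp bq hz vz ncb ncp => /=; lia.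
  + by case: t {Pb Gp Gq} bp bq hz vz ncb ncp => /=; lia.
  exists r; first exact: between_chain Gp pr rz.
  by split; rewrite -lesN.
- have st : s = t by case: t s {Pb Gp Gq} bp bq hz vz ncb ncp => [] [] /=; lia.
  subst s; have [|||r [pr rz r1 r2]] := chain_exit_row (Gp t) nKb.
  + by case: t {Pb Gp Gq} bp bq hz vz ncb ncp => /=; lia.
  + by case: t {Pb Gp Gq} bp bq hz vz ncb ncp => /=; lia.
  + by case: t {Pb Gp Gq} bp bq hz vz ncb ncp => /=; lia.
  exists r; first exact: between_chain Gp pr rz.
  by split.
Qed.

Lemma finite_box (B : set Z2) (l h : Z2) :
  (forall b, B b -> lep true l b /\ lep true b h) -> finite_set B.
Proof.
move=> Blh; pose n1 := `|h.1 - l.1|%N; pose n2 := `|h.2 - l.2|%N.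
apply: (@sub_finite_set _ _
  ((fun p : nat * nat => (l.1 + Posz p.1, l.2 + Posz p.2)) @` (`I_n1.+1 `*` `I_n2.+1))).
  move=> [i j] /Blh [[/= li lj] [/= ih jh]].
  exists (`|i - l.1|%N, `|j - l.2|%N); first by split; rewrite /= /n1 /n2; lia.
  by congr (_, _); rewrite /=; lia.
by apply: finite_image; apply: finite_setX; exact: finite_II.
Qed.

(** A discrete intermediate value argument: on the way from [a] to [b] in direction [s], some step
    makes [P] true. *)
Lemma switch (P : int -> Prop) s a b : les s a b -> ~ P a -> P b ->
  exists2 w, ~ P w & P (w + sg s).
Proof.
have H n c : ~ P c -> P (c + sg s * Posz n) -> exists2 w, ~ P w & P (w + sg s).
  elim: n c => [|n IH] c nPc Pn; first by case: nPc; rewrite mulr0 addr0 in Pn.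
  have [Pc|nPc'] := pselect (P (c + sg s)); first by exists c.
  apply: IH nPc' _; suff -> : c + sg s + sg s * Posz n = c + sg s * Posz n.+1 by [].
  by case: s {Pn} => /=; lia.
move=> ab nPa Pb; apply: (H `|b - a|%N a) => //.
suff -> : a + sg s * Posz `|b - a|%N = b by [].
by case: s ab {H} => /=; lia.
Qed.

Definition stepping (K : set Z2) := forall s p, K p ->
  K (p.1 - sg s, p.2) \/ K (p.1, p.2 + sg s).

(** The analogue of [chain_exit_row] without a prescribed target: a walk inside [K] along row [j]
    towards the excluded point [(i, j)] has to turn before reaching it. *)
Lemma stepping_exit_row K s i j a : stepping K -> ~ K (i, j) ->
  K (a, j) -> les s i a -> exists q, [/\ K q, les s i q.1 & les s (j + sg s) q.2].
Proof.
move=> Ks nK; have [n] := ubnP `|a - i|%N.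
elim: n a => // n IH a an Ka ia; have [|Kv] /= := Ks s (a, j) Ka; last first.
  by exists (a, j + sg s); split=> //=; exact: les_refl.
have ai : a <> i by move=> ai; subst a.
by move=> Kh; apply: IH Kh _; case: s ia => /=; lia.
Qed.

Lemma stepping_exit_col K s i j a : stepping K -> ~ K (i, j) ->
  K (i, a) -> les s a j -> exists q, [/\ K q, les s q.1 (i - sg s) & les s q.2 j].
Proof.
move=> Ks nK; have [n] := ubnP `|a - j|%N.
elim: n a => // n IH a an Ka aj; have [Kh|] /= := Ks s (i, a) Ka.
  by exists (i - sg s, a); split=> //=; exact: les_refl.
have naj : a <> j by move=> E; subst a.
by move=> Kh; apply: IH Kh _; case: s aj => /=; lia.
Qed.

(** * Classification of connected sets with stepping complement *)

Section Dichotomy.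
Variables (K : set Z2) (o : Z2).
Let B := ~` K.
Hypothesis nKo : ~ K o.
Hypothesis Bconn : connected_from o B.
Hypothesis Kstep : stepping K.

(** Having no point of [K] beyond it is a property that propagates from [o] along [B]; a point with
    some [k] beyond it is thus not in [B]. For [s = true], [K] is then a down-set. *)
Lemma closed_side s :
  ~ (exists2 k, K k & lep s o k) ->
  forall b k, K k -> lep s b k -> K b.
Proof.
move=> no b k Kk bk; apply: contrapT => nKb.
pose P := [set c | ~ exists2 k, K k & lep s c k].
suff /(_ b nKb) : B `<=` P by apply; exists k.
apply: Bconn => // {nKb no}b c Pb Bb Bc [t bc] [{Kk bk}k Kk [ck1 ck2]].
have [bk|nbk] := pselect (lep s b k); first by apply: Pb; exists k.
have [bc'|nbc] := pselect (lep s b c).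
  by apply: nbk; split; [apply: les_trans bc'.1 ck1|apply: les_trans bc'.2 ck2].
case: b c k => [i j] c [u v] in bc Bc Bb Kk ck1 ck2 nbk nbc Pb *; case: bc => cE; subst c;
  rewrite /lep /= in ck1 ck2 nbk nbc.
(* As [k] is beyond [c] but not beyond [b], it lies in the column of [c]. Its walk of orientation
   [~~ s] runs along this column towards [c], which is not in [K], and so turns off to a point
   beyond [b]. *)
- have [] := @stepping_exit_col K (~~ s) (i - sg t) j v Kstep Bc.
  + suff <- : u = i - sg t by [].
    by case: s t ck1 ck2 nbk nbc {Bc Bb Pb P} => [] [] /=; lia.
  + by rewrite lesN.
  move=> q [Kq q1 q2]; apply: Pb; exists q => //; rewrite !lesN in q1 q2.
  split=> //=; suff -> : i = i - sg t - sg (~~ s) by [].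
  by case: s t ck1 ck2 nbk nbc {Bc Bb P q1 q2} => [] [] /=; lia.
- have [] := @stepping_exit_row K s i (j + sg t) u Kstep Bc.
  + suff <- : v = j + sg t by [].
    by case: s t ck1 ck2 nbk nbc {Bc Bb Pb P} => [] [] /=; lia.
  + by [].
  move=> q [Kq q1 q2]; apply: Pb; exists q => //.
  split=> //=; suff -> : j = j + sg t + sg s by [].
  by case: s t ck1 ck2 nbk nbc {Bc Bb P q1 q2} => [] [] /=; lia.
Qed.

Hypothesis Kcol : forall s p, K p -> exists2 j, les s p.2 j & K (p.1 - sg s, j).
(** For [s = true]: if [K] is unbounded below in a column, it is so in the column to the west. This
    serves to exclude columns contained in [K]. *)
Hypothesis Kcol_unbounded : forall s i,
  (forall h, exists2 j, les s j h & K (i, j)) ->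
  forall h, exists2 j, les s j h & K (i - sg s, j).

Lemma meets_every_column k i : K k -> exists j, K (i, j).
Proof.
have H s n p : K p -> exists j, K (p.1 - sg s * Posz n, j).
  elim: n p => [|n IH] [a c] Kp.
    by exists c; rewrite mulr0 subr0.
  have [j _ /IH [l Kl]] := Kcol s Kp; exists l.
  suff -> : a - sg s * Posz n.+1 = a - sg s - sg s * Posz n by [].
  by lia.
move=> Kk; have [ik|ki] := leP i k.1.
  have [j Kj] := H true `|k.1 - i|%N k Kk; exists j.
  by suff -> : i = k.1 - sg true * Posz `|k.1 - i|%N by []; rewrite /=; lia.
have [j Kj] := H false `|k.1 - i|%N k Kk; exists j.
by suff -> : i = k.1 - sg false * Posz `|k.1 - i|%N by []; rewrite /=; lia.
Qed.

(** By [closed_side], [K] is closed in the direction [s]. Each column contains points of both [K]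
    and [B], so it meets [B] in a half-line, whose end is [W]. *)
Lemma one_side s k : K k -> lep s o k ->
  ~ (exists2 k, K k & lep (~~ s) o k) ->
  exists W, decreasingZ W /\ forall b, B b <-> les s b.2 (W b.1).
Proof.
move=> Kk ok no.
have up b c : K c -> lep s c b -> K b.
  by move=> Kc [cb1 cb2]; apply: (closed_side no Kc); split; rewrite lesN.
have out i : exists j, ~ K (i, j).
  have [io|noi] := pselect (les s i o.1).
    by exists o.2 => Kio; apply: nKo; apply: up Kio _; split=> //; exact: les_refl.
  (* If column [i] lay in [K], unboundedness would carry over to the column of [o]; some point of
     [K] there would have [o] beyond it, and closure would put [o] in [K]. *)
  apply: contrapT => allK.
  have {}allK j : K (i, j) by apply: contrapT => h; apply: allK; exists j.
  have H n : forall h, exists2 j, les s j h & K (i - sg s * Posz n, j).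
    elim: n => [h|n IH].
      by exists h; [exact: les_refl|rewrite mulr0 subr0].
    suff -> : i - sg s * Posz n.+1 = i - sg s * Posz n - sg s.
      exact: Kcol_unbounded.
    by lia.
  have [j jo Kj] := H `|i - o.1|%N o.2; apply: nKo; apply: up Kj _; split=> //=.
  by case: s noi {ok no H jo} => /=; lia.
have /choice [W WP] i : exists w, forall j, ~ K (i, j) <-> les s j w.
  have [a nKa] := out i; have [c Kc] := meets_every_column i Kk.
  have [ac|nac] := pselect (les s a c); last first.
    case: nKa; apply: up Kc _; split; first exact: les_refl.
    by case: s nac {ok no} => /=; lia.
  have [w nKw Kw] := @switch (fun j => K (i, j)) s a c ac nKa Kc.
  exists w => j; split=> [nKj|jw Kj].
    apply: contrapT => njw; apply: nKj; apply: up Kw _.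
    split; first exact: les_refl.
    by case: s njw {ok no ac} => /=; lia.
  by apply: nKw; apply: up Kj _; split=> //; exact: les_refl.
exists W; split; last by move=> [i j]; exact: WP.
have dec i : les s (W (i + sg s)) (W i).
  apply/WP => Ki; have [_] := WP (i + sg s) (W (i + sg s)).
  apply; first exact: les_refl.
  apply: up Ki _; split; last exact: les_refl.
  by case: s {ok no WP} => /=; lia.
move=> n; case: s dec {ok no up WP} => /= dec; first exact: dec.
by have := dec (n + 1); rewrite addrK.
Qed.

Hypothesis Kmerge : forall s k1 k2, K k1 -> K k2 ->
  exists2 z, chain K s k1 z & chain K s k2 z.

(** The chains from [k1] and [k2] merge at [z true] and at [z false]; the resulting loop traps [B],
    hence confines it to the box with these corners. *)
Lemma both_sides : (forall s, exists2 k, K k & lep s o k) -> finite_set B.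
Proof.
move=> h; have [k1 Kk1 ok1] := h true; have [k2 Kk2 ok2] := h false.
have /choice [z zP] s : exists z, chain K s k1 z /\ chain K s k2 z.
  by have [z] := Kmerge s Kk1 Kk2; exists z.
have Bsub : B `<=` [set b | forall s, exists2 k, between K z k & lep s b k].
  apply: (trapped Bconn) => // -[].
    by exists k1 => // s; have [] := zP s.
  by exists k2 => // s; have [] := zP s.
apply: (@finite_box _ ((z true).1, (z false).2) ((z false).1, (z true).2)).
move=> b /Bsub Bb; have [p Gp [bp1 bp2]] := Bb true; have [q Gq [bq1 bq2]] := Bb false.
have [[]] := (chain_mono (Gp true), chain_mono (Gp false)).
have [[]] := (chain_mono (Gq true), chain_mono (Gq false)).
move: bp1 bp2 bq1 bq2; rewrite /lep /=; lia.
Qed.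

Lemma tetrachotomy : [\/ finite_set B, B = [set: Z2],
  (exists W, decreasingZ W /\ B = region_le W) |
  (exists W, decreasingZ W /\ B = region_ge W)].
Proof.
pose S s := exists2 k, K k & lep s o k.
have [[k1 Kk1 ok1]|no1] := pselect (S true).
  have [[k2 Kk2 ok2]|no2] := pselect (S false).
    apply: Or41; apply: both_sides => -[]; [by exists k1|by exists k2].
  have [W [Wd WP]] := one_side Kk1 ok1 no2.
  by apply: Or43; exists W; split=> //; apply/seteqP; split=> b /WP.
have [[k2 Kk2 ok2]|no2] := pselect (S false).
  have [W [Wd WP]] := one_side Kk2 ok2 no1.
  by apply: Or44; exists W; split=> //; apply/seteqP; split=> b /WP.
(* Here [K] is closed downwards and upwards, so a point of [K] would bring [o] into [K] by way of
   the meet [m]. *)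
apply: Or42; apply/seteqP; split=> // b _ Kb; apply: nKo.
pose m : Z2 := (Order.min b.1 o.1, Order.min b.2 o.2).
have Km : K m by apply: (closed_side no1 Kb); rewrite /m; split=> /=; lia.
by apply: (closed_side no2 Km); rewrite /m; split=> /=; lia.
Qed.
End Dichotomy.

(** * Independence *)

Definition rect (s : seq Z2) (B : Z2 -> set powE) : set env :=
  [set G | forall z, z \in s -> B z (G z)].

(** A pi-system, to which uniqueness of measures applies, generating the events that depend on the
    sites of [S] only. *)
Definition rects (S : set Z2) : set (set env) :=
  [set E | exists s B, (forall z, z \in s -> S z) /\ E = rect s B].

Definition sigma_on (S : set Z2) : set (set env) := <<s rects S >>.

Lemma sub_rect s s' B : s =i s' -> rect s B = rect s' B.
Proof. by move=> ss; apply/seteqP; split=> G h z; [rewrite -ss|rewrite ss]; exact: h. Qed.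

Lemma rects_setI S : setI_closed (rects S).
Proof.
move=> _ _ [s [B [sS ->]]] [t [C [tS ->]]].
exists (s ++ t), (fun z => [set A | (z \in s -> B z A) /\ (z \in t -> C z A)]).
split=> [z|]; first by rewrite mem_cat => /orP[/sS|/tS].
apply/seteqP; split=> [G [Gs Gt] z _|G GI].
  by split=> [/Gs|/Gt].
split=> z zs; have /GI [h1 h2] : z \in s ++ t by rewrite mem_cat zs ?orbT.
  exact: h1.
exact: h2.
Qed.

Lemma rects_setT S : rects S setT.
Proof. by exists [::], (fun=> setT); split=> //; apply/seteqP; split. Qed.

Lemma measurable_site z (B : set powE) : measurable [set G : env | B (G z)].
Proof. by apply: sub_sigma_algebra; exists z => //; exists B. Qed.

Lemma measurable_rect s B : measurable (rect s B).
Proof.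
rewrite (_ : rect s B = [set G | forall z, z \in s -> B z (G z)])//.
apply: measurable_all => z; apply: measurable_imp; first exact: measurable_const_prop.
exact: measurable_site.
Qed.

Lemma sub_rects S S' : S `<=` S' -> rects S `<=` rects S'.
Proof. by move=> SS' _ [s [B [sS ->]]]; exists s, B; split=> // z /sS /SS'. Qed.

Lemma sub_sigma_on S S' : S `<=` S' -> sigma_on S `<=` sigma_on S'.
Proof.
by move=> SS'; apply: sub_sigma_algebra2; exact: sub_rects.
Qed.

Lemma sigma_on_measurable S : sigma_on S `<=` measurable.
Proof.
apply: smallest_sub; first exact: sigma_algebra_measurable.
by move=> _ [s [B [_ ->]]]; exact: measurable_rect.
Qed.

Lemma measurable_sigma_on : measurable `<=` sigma_on setT.
Proof.
apply: smallest_sub; first exact: smallest_sigma_algebra.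
move=> _ [z _ [B _ <-]]; apply: sub_sigma_algebra.
exists [:: z], (fun=> B); split=> //; apply/seteqP; split=> [G Gz w|G]; last first.
  by apply; exact: mem_head.
by rewrite inE => /eqP ->.
Qed.

Lemma sigma_on_site (S : set Z2) z (B : set powE) : S z -> sigma_on S [set G | B (G z)].
Proof.
move=> Sz; apply: sub_sigma_algebra; exists [:: z], (fun=> B); split.
  by move=> w; rewrite inE => /eqP ->.
apply/seteqP; split=> [G Gz w|G]; first by rewrite inE => /eqP ->.
by apply; exact: mem_head.
Qed.

Lemma sigma_onI S E F : sigma_on S E -> sigma_on S F -> sigma_on S (E `&` F).
Proof. exact: (@measurableI _ (g_sigma_algebraType (rects S))). Qed.
Lemma sigma_onU S E F : sigma_on S E -> sigma_on S F -> sigma_on S (E `|` F).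
Proof. exact: (@measurableU _ (g_sigma_algebraType (rects S))). Qed.
Lemma sigma_onC S E : sigma_on S E -> sigma_on S (~` E).
Proof. exact: (@measurableC _ (g_sigma_algebraType (rects S))). Qed.
Lemma sigma_on0 S : sigma_on S set0.
Proof. exact: (@measurable0 _ (g_sigma_algebraType (rects S))). Qed.
Lemma sigma_onT S : sigma_on S setT.
Proof. exact: (@measurableT _ (g_sigma_algebraType (rects S))). Qed.

Section Product.
Context (R : realType) (mu : probability powE R) (nu : probability env R).
Hypothesis nu_prod : is_product_measure mu nu.

Definition pr (E : set env) : R := fine (nu E).

Lemma prE E : measurable E -> nu E = (pr E)%:E.
Proof. by move=> mE; rewrite fineK// fin_num_measure. Qed.

Lemma pr_ge0 E : 0 <= pr E. Proof. exact: fine_ge0. Qed.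

Lemma le_pr E F : measurable E -> measurable F -> E `<=` F -> pr E <= pr F.
Proof.
by move=> mE mF EF; rewrite -lee_fin -!prE//; apply: le_measure; rewrite ?inE.
Qed.

Lemma prT : pr setT = 1. Proof. by rewrite /pr probability_setT. Qed.

Lemma pr_le1 E : measurable E -> pr E <= 1.
Proof. by move=> mE; rewrite -prT; exact: le_pr. Qed.

Lemma pr0 : pr set0 = 0. Proof. by rewrite /pr measure0. Qed.

Lemma pr_disjointU E F : measurable E -> measurable F -> E `&` F = set0 ->
  pr (E `|` F) = pr E + pr F.
Proof.
move=> mE mF EF; apply: EFin_inj; rewrite -prE; last exact: measurableU.
by rewrite measureU// EFinD -!prE.
Qed.

Lemma pr_subadd E F : measurable E -> measurable F -> pr (E `|` F) <= pr E + pr F.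
Proof.
move=> mE mF; have -> : E `|` F = E `|` (F `\` E) by rewrite setUDr setDv setD0.
rewrite pr_disjointU ?setDIK //; [|exact: measurableD].
by rewrite lerD2l; apply: le_pr => //; exact: measurableD.
Qed.

Lemma nu_rect s B : nu (rect s B) = (\prod_(z <- undup s) mu (B z))%E.
Proof.
rewrite -(nu_prod B (undup_uniq s)); congr (nu _).
by apply: sub_rect => z; rewrite mem_undup.
Qed.

Lemma rect_indep s t B C : (forall z, z \in s -> z \in t -> False) ->
  nu (rect s B `&` rect t C) = (nu (rect s B) * nu (rect t C))%E.
Proof.
move=> st; pose D z := if z \in s then B z else C z.
have -> : rect s B `&` rect t C = rect (undup s ++ undup t) D.
  apply/seteqP; split=> [G [Gs Gt] z|G GD].
    rewrite /D mem_cat !mem_undup; case: ifP => [zs _|_ /= zt]; first exact: Gs.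
    exact: Gt.
  split=> z zs.
    by have := GD z; rewrite /D mem_cat !mem_undup zs; apply.
  have := GD z; rewrite /D mem_cat !mem_undup zs orbT.
  case: ifP => [zs'|_]; last by apply.
  by case: (st z).
rewrite !nu_rect undup_id; last first.
  rewrite cat_uniq !undup_uniq andbT /= -all_predC; apply/allP => z.
  by rewrite /= !mem_undup => zt; apply/negP => zs; exact: (st z).
rewrite big_cat /=; congr (_ * _)%E; apply: eq_big_seq => z; rewrite mem_undup /D.
  by move=> ->.
by move=> zt; case: ifP => // zs; case: (st z).
Qed.

(** Both sides are finite measures in [E]: the restriction of [nu] to [F] and a multiple of [nu].
    Agreeing on the pi-system [P], they agree on the sigma-algebra it generates. *)
Lemma indep_sigma (P : set (set env)) (F : set env) :
  setI_closed P -> P setT -> P `<=` measurable -> measurable F ->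
  (forall E, P E -> nu (E `&` F) = (nu E * nu F)%E) ->
  forall E, <<s P >> E -> nu (E `&` F) = (nu E * nu F)%E.
Proof.
move=> PI PT Pm mF PF E sE.
have frE : nu F = (fine (nu F))%:E by rewrite -prE.
pose r : {nonneg R} := NngNum (fine_ge0 (measure_ge0 nu F)).
have : mrestr nu mF E = mscale r nu E.
  apply: (@g_sigma_algebra_measure_unique _ _ _ P Pm (fun=> setT)) sE => //.
  - by apply/seteqP; split=> // x _; exists 0%N.
  - move=> A PA; transitivity (nu A * nu F)%E; first exact: PF.
    by rewrite muleC frE.
  - move=> _; apply: (@le_lt_trans _ _ (nu F)); last by rewrite frE ltry.
    by apply: le_measure; rewrite ?inE //; exact: measurableI.
by move=> h; transitivity (mscale r nu E) => //; rewrite [RHS]muleC [in RHS]frE.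
Qed.

Lemma indep_on S T E F : S `&` T = set0 -> sigma_on S E -> sigma_on T F ->
  nu (E `&` F) = (nu E * nu F)%E.
Proof.
move=> ST SE TF.
have rm U : rects U `<=` measurable.
  by move=> _ [s [B [_ ->]]]; exact: measurable_rect.
(* One factor at a time: [E] is reduced to a rectangle, then [F]. *)
apply: (indep_sigma (@rects_setI S) (rects_setT S) (rm S)) SE.
  exact: sigma_on_measurable TF.
move=> _ [s [B [sS ->]]]; rewrite setIC muleC.
apply: (indep_sigma (@rects_setI T) (rects_setT T) (rm T)) TF.
  exact: measurable_rect.
move=> _ [t [C [tT ->]]]; apply: rect_indep => z zt zs.
by have : (S `&` T) z by [split; [exact: sS|exact: tT]]; rewrite ST.
Qed.

Lemma pr_indep S T E F : S `&` T = set0 -> sigma_on S E -> sigma_on T F ->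
  pr (E `&` F) = pr E * pr F.
Proof.
move=> ST SE TF; rewrite /pr (indep_on ST SE TF) fineM //.
  by rewrite fin_num_measure//; exact: sigma_on_measurable SE.
by rewrite fin_num_measure//; exact: sigma_on_measurable TF.
Qed.

Lemma pr_split E F : measurable E -> measurable F ->
  pr E = pr (E `&` F) + pr (E `&` ~` F).
Proof.
move=> mE mF; rewrite -pr_disjointU; first by rewrite -setIUr setUv setIT.
- exact: measurableI.
- by apply: measurableI => //; exact: measurableC.
- by rewrite setIACA setICr setI0.
Qed.

Lemma pr_site z (B : set powE) : pr [set G | B (G z)] = fine (mu B).
Proof.
rewrite /pr; have := @nu_prod [:: z] (fun=> B) erefl; rewrite big_seq1 => <-.
congr (fine (nu _)); apply/seteqP; split=> [G Gz w|G]; last by apply; exact: mem_head.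
by rewrite inE => /eqP ->.
Qed.

Lemma pr_siteC z (B : set powE) : pr [set G | ~ B (G z)] = 1 - fine (mu B).
Proof.
rewrite -(pr_site z) -prT (@pr_split setT [set G | B (G z)])//; last exact: measurable_site.
by rewrite !setTI addrAC subrr add0r.
Qed.

Lemma negligible_le E : measurable E -> (forall e : R, 0 < e -> pr E <= e) ->
  nu.-negligible E.
Proof.
move=> mE Ee; apply/negligibleP => //; transitivity (pr E)%:E; first exact: prE.
congr (_%:E); apply/eqP.
by rewrite eq_le pr_ge0 andbT; apply/ler_addgt0Pl => e e0; rewrite addr0; exact: Ee.
Qed.

(** Transfers the statement for sequences through [unpickle], with a trivial property at integers
    that encode nothing. *)
Lemma ae_countable (I : countType) (P : I -> env -> Prop) :
  (forall i, {ae nu, forall G, P i G}) -> {ae nu, forall G, forall i, P i G}.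
Proof.
move=> aeP; have : {ae nu, forall G, forall n, (if unpickle n is Some i then P i G else True)}.
  by apply: ae_foralln => n; case: unpickle => [i|]; [exact: aeP|exact: nearW].
by apply: filterS => G h i; have := h (pickle i); rewrite pickleK.
Qed.

End Product.

(** * A lazy random walk on the naturals *)

Section BoundedHarmonic.
Context (R : realType) (alpha beta : R).
Hypotheses (alpha0 : 0 <= alpha) (alphabeta : alpha <= beta) (beta0 : 0 < beta).
Hypothesis ab1 : alpha + beta <= 1.

Let c0 : 0 <= 1 - alpha - beta.
Proof. by have := ab1; lra. Qed.

(* The probability that the walk started at g, moving down with probability beta
   and up with probability alpha, does not reach 0 within T steps. *)
Fixpoint survival (T g : nat) : R :=
  if g is g'.+1 then
    if T is T'.+1 then
      beta * survival T' g' + alpha * survival T' g'.+2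
      + (1 - alpha - beta) * survival T' g'.+1
    else 1
  else 0.

Lemma survival_bounds T g : 0 <= survival T g <= 1.
Proof.
elim: T g => [|T IH] [|g] //=; rewrite ?lexx ?ler01//.
have := IH g; have := IH g.+1; have := IH g.+2.
set x := survival T g.+2; set y := survival T g.+1; set z := survival T g.
move=> /andP[x0 x1] /andP[y0 y1] /andP[z0 z1].
have hz := mulr_ge0 (ltW beta0) z0; have hz' := ler_wpM2l (ltW beta0) z1.
have hx := mulr_ge0 alpha0 x0; have hx' := ler_wpM2l alpha0 x1.
have hy := mulr_ge0 c0 y0; have hy' := ler_wpM2l c0 y1.
by apply/andP; split; lra.
Qed.

Lemma survivalS T g : survival T.+1 g.+1 =
  beta * survival T g + alpha * survival T g.+2
  + (1 - alpha - beta) * survival T g.+1.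
Proof. by []. Qed.

Lemma survival_nonincreasing g : nonincreasing_seq (survival ^~ g).
Proof.
apply/nonincreasing_seqP => T; elim: T g => [|T IH] [|g]; try exact: lexx.
  by have /andP[] := survival_bounds 1 g.+1.
rewrite survivalS [leRHS]survivalS; apply: lerD; first apply: lerD.
- by apply: ler_wpM2l (IH g); exact: ltW.
- exact: (ler_wpM2l alpha0 (IH g.+2)).
- exact: (ler_wpM2l c0 (IH g.+1)).
Qed.

(* The increments d of Q satisfy alpha * d (g+1) = beta * d g, so they are
   nondecreasing and boundedness forces the first one to vanish. *)
Lemma harmonic0 (Q : nat -> R) : Q 0%N = 0 -> (forall g, 0 <= Q g <= 1) ->
  (forall g, Q g.+1 = beta * Q g + alpha * Q g.+2 + (1 - alpha - beta) * Q g.+1) ->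
  forall g, Q g = 0.
Proof.
move=> Q0 Q01 Qh.
have step g : alpha * (Q g.+2 - Q g.+1) = beta * (Q g.+1 - Q g).
  by have := Qh g; lra.
have Q1 : 0 <= Q 1%N by have /andP[] := Q01 1%N.
have incr g : Q 1%N <= Q g.+1 - Q g.
  elim: g => [|g IH]; first by rewrite Q0 subr0.
  (* For [alpha = 0] the recurrence makes every increment vanish. *)
  have st := step g; have [a0|a0] := eqVneq alpha 0.
    rewrite a0 mul0r in st; have : Q g.+1 - Q g = 0.
      by apply/eqP; rewrite -(mulrI_eq0 _ (lregP (lt0r_neq0 beta0))) -st.
    have Qg := step g.+1; rewrite a0 mul0r in Qg.
    have : Q g.+2 - Q g.+1 = 0.
      by apply/eqP; rewrite -(mulrI_eq0 _ (lregP (lt0r_neq0 beta0))) -Qg.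
    by lra.
  have alpha_gt0 : 0 < alpha by rewrite lt_neqAle eq_sym a0.
  rewrite -(ler_pM2l alpha_gt0) st; apply: le_trans (ler_wpM2l alpha0 IH) _.
  by rewrite ler_wpM2r//; apply: le_trans IH.
have lin g : Q 1%N *+ g <= Q g.
  elim: g => [|g IH]; first by rewrite Q0.
  by rewrite mulrS; have := incr g; lra.
have Q10 : Q 1%N = 0.
  apply/eqP; rewrite eq_le Q1 andbT leNgt; apply/negP => Q1gt0.
  pose n := Num.truncn (Q 1%N)^-1.
  have n1 : (Q 1%N)^-1 < n.+1%:R by exact: truncnS_gt.
  have := lin n.+1; have /andP[_] := Q01 n.+1.
  rewrite -mulr_natr => h1 h2.
  have : 1 < Q 1%N * n.+1%:R by rewrite -ltr_pdivrMl// mulr1.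
  by lra.
(* Two consecutive zeros force the next. When [alpha = 0], the recurrence at [g] says nothing about
   [Q g.+2], so the one at [g.+1] is used. *)
suff H g : Q g = 0 /\ Q g.+1 = 0 by move=> g; have [] := H g.
elim: g => [|g [IH1 IH2]]; first by [].
split=> //; have := step g; rewrite IH1 IH2 !subr0 mulr0 => aQ.
have [a0|a0] := eqVneq alpha 0; last first.
  by apply/eqP; move/eqP: aQ; rewrite mulf_eq0 (negbTE a0).
have := step g.+1; rewrite a0 mul0r IH2 subr0 => /eqP; rewrite eq_sym mulf_eq0.
by rewrite (negbTE (lt0r_neq0 beta0)) => /eqP.
Qed.

(** The sequence decreases in [T]; passing to the limit in its recursion gives a bounded function to
    which [harmonic0] applies. *)
Lemma survival_cvg0 g : survival ^~ g @ \oo --> (0 : R).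
Proof.
pose Q g := limn (survival ^~ g).
have cv k : survival ^~ k @ \oo --> Q k.
  apply: nonincreasing_is_cvgn; first exact: survival_nonincreasing.
  by exists 0 => _ [T _ <-]; have /andP[] := survival_bounds T k.
suff <- : Q g = 0 by exact: cv.
apply: harmonic0.
- by rewrite /Q (_ : survival ^~ 0%N = cst 0); [exact: lim_cst|apply/funext => -[]].
- move=> k; apply/andP; split.
    by apply: limr_ge; [exact: cv|apply: nearW => T; have /andP[] := survival_bounds T k].
  by apply: limr_le; [exact: cv|apply: nearW => T; have /andP[] := survival_bounds T k].
- move=> k; have cvS : (fun T => survival T.+1 k.+1) @ \oo --> Q k.+1.
    by have := cv k.+1; rewrite -cvg_shiftS.
  apply: (cvg_unique _ cvS) => //.
  by apply: cvgD; [apply: cvgD|]; apply: cvgM (cv _); exact: cvg_cst.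
Qed.

End BoundedHarmonic.

(** * Meeting of two paths *)

Definition hor (s : bool) (p : Z2) : Z2 := (p.1 - sg s, p.2).
Definition ver (s : bool) (p : Z2) : Z2 := (p.1, p.2 + sg s).
Definition hor_open (s : bool) : set powE := [set A | vec A (- sg s, 0)].
Definition ver_open (s : bool) : set powE := [set A | vec A (0, sg s)].

Definition follow_hor s (G : env) (p : Z2) : Z2 :=
  if `[< hor_open s (G p) >] then hor s p else ver s p.
Definition follow_ver s (G : env) (p : Z2) : Z2 :=
  if `[< ver_open s (G p) >] then ver s p else hor s p.

(* The first walker turns horizontal, the second vertical, whenever it can. *)
Fixpoint apart s (T : nat) (u v : Z2) (G : env) : Prop :=
  u <> v /\ (if T is T'.+1 then apart s T' (follow_hor s G u) (follow_ver s G v) G else True).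

(** The time coordinate of a walker: either kind of step raises it by 1, so no site is read
    twice. *)
Definition level s (p : Z2) : int := sg s * (p.2 - p.1).

Lemma level_hor s p : level s (hor s p) = level s p + 1.
Proof. by rewrite /level /hor; case: s => /=; lia. Qed.
Lemma level_ver s p : level s (ver s p) = level s p + 1.
Proof. by rewrite /level /ver; case: s => /=; lia. Qed.

(** Once the outcomes at [u] and [v] are fixed, the next positions are deterministic and the event
    factors. *)
Lemma apartS_setI s T u v (A B : bool) : u <> v ->
  apart s T.+1 u v `&`
    [set G | (if A then hor_open s else ~` hor_open s) (G u)] `&`
    [set G | (if B then ver_open s else ~` ver_open s) (G v)] =
  [set G | (if A then hor_open s else ~` hor_open s) (G u)] `&`
  ([set G | (if B then ver_open s else ~` ver_open s) (G v)] `&`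
  apart s T (if A then hor s u else ver s u) (if B then ver s v else hor s v)).
Proof.
move=> uv; have fh G : (if A then hor_open s else ~` hor_open s) (G u) ->
    follow_hor s G u = if A then hor s u else ver s u.
  by rewrite /follow_hor; case: A => h; case: asboolP => // /h.
have fv G : (if B then ver_open s else ~` ver_open s) (G v) ->
    follow_ver s G v = if B then ver s v else hor s v.
  by rewrite /follow_ver; case: B => h; case: asboolP => // /h.
apply/seteqP; split=> G.
  by move=> [[[_ ap] hA] hB]; rewrite fh// fv// in ap.
by move=> [hA [hB ap]]; split=> //; split=> //; split=> //; rewrite fh// fv.
Qed.

Lemma set_split (T : Type) (E F : set T) : E = (E `&` F) `|` (E `&` ~` F).
Proof. by rewrite -setIUr setUv setIT. Qed.

Lemma sigma_on_apart s T u v c : c <= level s u -> c <= level s v ->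
  sigma_on [set z | c <= level s z] (apart s T u v).
Proof.
elim: T u v => [|T IH] u v cu cv.
  have [->|/eqP uv] := eqVneq u v.
    by rewrite (_ : apart _ _ _ _ = set0); [exact: sigma_on0|apply/seteqP; split=> // G []].
  by rewrite (_ : apart _ _ _ _ = setT); [exact: sigma_onT|apply/seteqP; split].
have [->|/eqP uv] := eqVneq u v.
  by rewrite (_ : apart _ _ _ _ = set0); [exact: sigma_on0|apply/seteqP; split=> // G []].
have piece A B : sigma_on [set z | c <= level s z] (apart s T.+1 u v `&`
    [set G | (if A then hor_open s else ~` hor_open s) (G u)] `&`
    [set G | (if B then ver_open s else ~` ver_open s) (G v)]).
  rewrite apartS_setI//; apply: sigma_onI; first exact: sigma_on_site.
  apply: sigma_onI; first exact: sigma_on_site.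
  apply: IH; [case: A|case: B]; rewrite ?level_hor ?level_ver; lia.
rewrite (set_split (apart s T.+1 u v) [set G | hor_open s (G u)]).
apply: sigma_onU.
  rewrite (set_split (_ `&` _) [set G | ver_open s (G v)]).
  by apply: sigma_onU; [exact: (piece true true)|exact: (piece true false)].
rewrite (set_split (_ `&` _) [set G | ver_open s (G v)]).
by apply: sigma_onU; [exact: (piece false true)|exact: (piece false false)].
Qed.

Lemma measurable_apart s T u v : measurable (apart s T u v).
Proof.
have [uv|vu] := leP (level s u) (level s v).
  exact: sigma_on_measurable (sigma_on_apart T (lexx _) uv).
exact: sigma_on_measurable (sigma_on_apart T (ltW vu) (lexx _)).
Qed.

Section Walkers.
Context (R : realType) (mu : probability powE R) (nu : probability env R).
Hypothesis nu_prod : is_product_measure mu nu.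
Variable s : bool.
Let p := fine (mu (hor_open s)).
Let r := fine (mu (ver_open s)).

(** The three factors depend on [u], on [v] and on strictly higher levels, which are disjoint sets
    of sites. *)
Lemma pr_piece T u v (A B : bool) : level s u = level s v -> u <> v ->
  pr nu (apart s T.+1 u v `&`
    [set G | (if A then hor_open s else ~` hor_open s) (G u)] `&`
    [set G | (if B then ver_open s else ~` ver_open s) (G v)]) =
  (if A then p else 1 - p) * ((if B then r else 1 - r) *
   pr nu (apart s T (if A then hor s u else ver s u) (if B then ver s v else hor s v))).
Proof.
move=> luv uv; rewrite apartS_setI//.
have later : sigma_on [set z | level s v + 1 <= level s z]
    (apart s T (if A then hor s u else ver s u) (if B then ver s v else hor s v)).
  by apply: sigma_on_apart; [case: A|case: B]; rewrite ?level_hor ?level_ver; lia.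
have Sv : sigma_on [set v] [set G | (if B then ver_open s else ~` ver_open s) (G v)].
  exact: sigma_on_site.
have Su : sigma_on [set u] [set G | (if A then hor_open s else ~` hor_open s) (G u)].
  exact: sigma_on_site.
rewrite (pr_indep nu_prod _ Su (T := [set v] `|` [set z | level s v + 1 <= level s z])).
- congr (_ * _).
    by case: A {Su later}; [exact: (pr_site nu_prod)|exact: (pr_siteC nu_prod)].
  rewrite (pr_indep nu_prod _ Sv later).
    congr (_ * _).
    by case: B {Sv later}; [exact: (pr_site nu_prod)|exact: (pr_siteC nu_prod)].
  by apply/seteqP; split=> // z [-> /=]; lia.
- by apply/seteqP; split=> // z [-> [//|/=]]; rewrite luv; lia.
- apply: sigma_onI; first by apply: sub_sigma_on Sv => z; left.
  by apply: sub_sigma_on later => z; right.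
Qed.

(** The gap [g] shrinks by 1 if [u] moves horizontally and [v] vertically, with probability [p * r];
    it grows by 1 in the opposite case, with probability [(1 - p) * (1 - r)]; otherwise it is
    unchanged. *)
Lemma pr_apart T g u v : u = (v.1 + sg s * Posz g, v.2 + sg s * Posz g) ->
  pr nu (apart s T u v) = survival ((1 - p) * (1 - r)) (p * r) T g.
Proof.
elim: T g u v => [|T IH] [|g] u v uE.
- rewrite (_ : apart _ _ _ _ = set0); first by rewrite pr0.
  apply/seteqP; split=> // G []; case; rewrite uE mulr0 !addr0; by case: v {uE}.
- rewrite (_ : apart _ _ _ _ = setT); first by rewrite prT.
  by apply/seteqP; split=> // G _; split=> //; rewrite uE; case: v s {uE} => x y [] [] /=; lia.
- rewrite (_ : apart _ _ _ _ = set0); first by rewrite pr0.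
  apply/seteqP; split=> // G []; case; rewrite uE mulr0 !addr0; by case: v {uE}.
have uv : u <> v by rewrite uE; case: v s {uE} => x y [] [] /=; lia.
have luv : level s u = level s v by rewrite uE /level; case: s {uE} => /=; lia.
have m := measurable_apart s T.+1 u v.
have mH : measurable [set G : env | hor_open s (G u)] by exact: measurable_site.
have mV : measurable [set G : env | ver_open s (G v)] by exact: measurable_site.
rewrite (pr_split _ m mH) (pr_split _ (measurableI _ _ m mH) mV).
rewrite (pr_split _ (measurableI _ _ m (measurableC mH)) mV).
rewrite (pr_piece _ true true)// (pr_piece _ true false)//.
rewrite (pr_piece _ false true)// (pr_piece _ false false)//.
rewrite (IH g (hor s u) (ver s v)) ?(IH g.+1 (hor s u) (hor s v))
  ?(IH g.+1 (ver s u) (ver s v)) ?(IH g.+2 (ver s u) (hor s v)).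
- by rewrite survivalS; ring.
all: by rewrite uE /hor /ver /=; congr (_, _); case: s {m mH mV uE luv IH}; lia.
Qed.

Hypotheses (p0 : 0 < p) (r0 : 0 < r) (pr1 : 1 <= p + r).

Lemma ae_meet v g : {ae nu, forall G,
  exists T, ~ apart s T (v.1 + sg s * Posz g, v.2 + sg s * Posz g) v G}.
Proof.
set u := (_, _).
have mE : measurable [set G | forall T, apart s T u v G].
  by apply: measurable_all => T; exact: measurable_apart.
suff : nu.-negligible [set G | forall T, apart s T u v G].
  by apply: negligibleS => G h T; apply: contrapT => nap; apply: h; exists T.
apply: negligible_le => // e e0.
have [p1 r1] : p <= 1 /\ r <= 1.
  by split; rewrite -lee_fin /p /r fineK ?fin_num_measure// probability_le1.
have a0 : 0 <= (1 - p) * (1 - r) by rewrite mulr_ge0 ?subr_ge0.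
(* The nonpositive drift, equivalent to [1 <= p + r]. *)
have ab : (1 - p) * (1 - r) <= p * r by have := pr1; nra.
have ab1 : (1 - p) * (1 - r) + p * r <= 1.
  have q1 := mulr_ge0 (ltW p0) (ltW r0); have := p1; have := r1.
  have := mulr_ge0 (ltW p0) (_ : 0 <= 1 - r); rewrite subr_ge0 => /(_ r1).
  have := mulr_ge0 (ltW r0) (_ : 0 <= 1 - p); rewrite subr_ge0 => /(_ p1).
  lra.
have /cvgrPdist_le /(_ _ e0) [T _ /(_ T (leqnn T))] :=
  survival_cvg0 a0 ab (mulr_gt0 p0 r0) ab1 g.
rewrite sub0r normrN => HT; apply: le_trans (le_trans (ler_norm _) HT).
rewrite -(@pr_apart T g u v)//; apply: le_pr => //; exact: measurable_apart.
Qed.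

End Walkers.

(** * Almost sure properties of the environment *)

Section Sites.
Context (R : realType) (mu : probability powE R) (nu : probability env R).
Hypothesis nu_prod : is_product_measure mu nu.

Lemma pr_rect_cst l B : uniq l -> pr nu (rect l (fun=> B)) = fine (mu B) ^+ size l.
Proof.
move=> ul; transitivity (fine (\prod_(z <- l) mu B)%E).
  by congr fine; exact: (nu_prod (fun=> B) ul).
have -> : mu B = (fine (mu B))%:E by rewrite fineK// fin_num_measure.
elim: l {ul} => [|z l IH]; first by rewrite big_nil.
rewrite big_cons fineM//; first by rewrite IH exprS.
by elim: l {IH} => [|w l IH]; rewrite ?big_nil// big_cons fin_numM.
Qed.

(** By independence, [N] sites of the half-column all miss [B] with probability [(1 - mu B) ^ N],
    which tends to 0. *)
Lemma ae_site_unbounded (B : set powE) t i h : (0 < mu B)%E ->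
  {ae nu, forall G, exists2 j, les t j h & B (G (i, j))}.
Proof.
move=> B0; pose f n : Z2 := (i, h - sg t * Posz n).
have mE : measurable [set G : env | forall n, ~ B (G (f n))].
  by apply: measurable_all => n; exact: (measurable_site (f n) (~` B)).
suff : nu.-negligible [set G : env | forall n, ~ B (G (f n))].
  apply: negligibleS => G nex n Bn; apply: nex; exists (h - sg t * Posz n) => //.
  by case: t {mE f Bn} => /=; lia.
apply: negligible_le => // e e0.
have fB : mu B = (fine (mu B))%:E by rewrite fineK// fin_num_measure.
have [b0 b1] : 0 < fine (mu B) /\ fine (mu B) <= 1.
  by rewrite -lte_fin -lee_fin -fB; split=> //; exact: probability_le1.
have /cvgrPdist_le /(_ _ e0) [N _ /(_ N (leqnn N))] :
    (1 - fine (mu B)) ^+ n @[n --> \oo] --> (0 : R).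
  by apply: cvg_expr; rewrite ger0_norm; lra.
rewrite sub0r normrN => HN; apply: le_trans (le_trans (ler_norm _) HN).
have -> : 1 - fine (mu B) = fine (mu (~` B)).
  by rewrite probability_setC// fB.
rewrite -[in leRHS](size_iota 0 N) -(size_map f) -pr_rect_cst.
  apply: le_pr => //; first exact: measurable_rect.
  by move=> G h' z /mapP[n _ ->]; exact: h'.
rewrite map_inj_uniq ?iota_uniq// => m n [].
by case: t {mE f HN} => /=; lia.
Qed.

Lemma ae_site (B : set powE) z : mu B = 1%E -> {ae nu, forall G, B (G z)}.
Proof.
move=> B1; apply/negligibleP.
  exact: (measurable_site z (~` B)).
suff : pr nu [set G | ~ B (G z)] = 0.
  by move=> h; transitivity (pr nu [set G | ~ B (G z)])%:E;
     [apply: prE; exact: (measurable_site z (~` B))|rewrite h].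
by rewrite (pr_siteC nu_prod) B1 subrr.
Qed.

(** The almost sure properties that the classification uses; beyond them its argument is
    deterministic. *)
Record typical (G : env) : Prop := Typical {
  typical_open : forall s z, hor_open s (G z) \/ ver_open s (G z);
  typical_unbounded : forall s t i h, exists2 j, les t j h & hor_open s (G (i, j));
  typical_meet : forall s v g, exists T,
    ~ apart s T (v.1 + sg s * Posz g, v.2 + sg s * Posz g) v G }.

Lemma ae_typical : (forall s, (0 < mu (hor_open s))%E) ->
  (forall s, (0 < mu (ver_open s))%E) ->
  (forall s, mu (hor_open s `|` ver_open s) = 1%E) ->
  {ae nu, forall G, typical G}.
Proof.
move=> h0 v0 hv1.
have A : {ae nu, forall G : env, forall s z, hor_open s (G z) \/ ver_open s (G z)}.
  by apply: ae_countable => s; apply: ae_countable => z; exact: (ae_site z (hv1 s)).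
have B : {ae nu, forall G : env, forall s t i h, exists2 j, les t j h & hor_open s (G (i, j))}.
  do 4! apply: ae_countable => ?; exact: ae_site_unbounded.
have C : {ae nu, forall G : env, forall s v g, exists T,
    ~ apart s T (v.1 + sg s * Posz g, v.2 + sg s * Posz g) v G}.
  apply: ae_countable => s; apply: ae_countable => v; apply: ae_countable => g.
  have fin D : mu D = (fine (mu D))%:E by rewrite fineK// fin_num_measure.
  apply: (ae_meet nu_prod); first by rewrite -lte_fin -fin.
    by rewrite -lte_fin -fin.
  (* The drift condition [1 <= p + r] is the union bound for an event of probability 1. *)
  rewrite -lee_fin EFinD -!fin -(hv1 s) ; exact: measureU2.
by apply: filterS3 A B C => G; exact: Typical.
Qed.

End Sites.

(** * Sets closed under the steps of a typical environment *)

Section TypicalEnvironment.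
Variables (G : env) (K : set Z2).
Hypothesis Gtyp : typical G.
Hypothesis Khor : forall s p, K p -> hor_open s (G p) -> K (hor s p).
Hypothesis Kver : forall s p, K p -> ver_open s (G p) -> K (ver s p).

Lemma typical_stepping : stepping K.
Proof.
move=> s p Kp; have [|] := typical_open Gtyp s p; first by left; exact: Khor.
by right; exact: Kver.
Qed.

Lemma closed_follow_hor s p : K p -> K (follow_hor s G p).
Proof.
move=> Kp; rewrite /follow_hor; case: asboolP => [|nh]; first exact: Khor.
by have [//|] := typical_open Gtyp s p; exact: Kver.
Qed.

Lemma closed_follow_ver s p : K p -> K (follow_ver s G p).
Proof.
move=> Kp; rewrite /follow_ver; case: asboolP => [|nh]; first exact: Kver.
by have [|//] := typical_open Gtyp s p; exact: Khor.
Qed.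

Lemma chain_follow_hor s p z : K p -> chain K s (follow_hor s G p) z -> chain K s p z.
Proof.
by move=> Kp; rewrite /follow_hor; case: ifP => _; [exact: chain_horiz|exact: chain_vert].
Qed.

Lemma chain_follow_ver s p z : K p -> chain K s (follow_ver s G p) z -> chain K s p z.
Proof.
by move=> Kp; rewrite /follow_ver; case: ifP => _; [exact: chain_vert|exact: chain_horiz].
Qed.

(** The walkers never leave [K], so their trajectories are chains up to the meeting point. *)
Lemma merge_of_meeting s T u v : K u -> K v -> ~ apart s T u v G ->
  exists2 z, chain K s u z & chain K s v z.
Proof.
elim: T u v => [|T IH] u v Ku Kv nap.
  have uv : u = v by apply: contrapT => h; apply: nap.
  by exists u; rewrite -?uv; exact: chain_nil.
have [uv|nuv] := pselect (u = v).
  by exists u; rewrite -?uv; exact: chain_nil.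
have [|||z uz vz] := IH (follow_hor s G u) (follow_ver s G v).
- exact: closed_follow_hor.
- exact: closed_follow_ver.
- by move=> ap; apply: nap.
by exists z; [exact: chain_follow_hor uz|exact: chain_follow_ver vz].
Qed.

Lemma chain_to_level s u c : K u -> level s u <= c ->
  exists2 w, chain K s u w & level s w = c.
Proof.
have [n] := ubnP `|c - level s u|%N; elim: n u => // n IH u un Ku uc.
have [<-|ne] := eqVneq (level s u) c; first by exists u => //; exact: chain_nil.
have [||w uw wc] := IH (follow_hor s G u) _ (closed_follow_hor s Ku).
- by rewrite /follow_hor; case: ifP => _; rewrite ?level_hor ?level_ver; lia.
- by rewrite /follow_hor; case: ifP => _; rewrite ?level_hor ?level_ver; lia.
by exists w => //; exact: chain_follow_hor uw.
Qed.

(** Both points are first moved to a common level, since [typical_meet] concerns walkers started on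
    one diagonal. *)
Lemma typical_merge s u v : K u -> K v -> exists2 z, chain K s u z & chain K s v z.
Proof.
move=> Ku Kv; pose c := Order.max (level s u) (level s v).
have [|u' uu' lu] := @chain_to_level s u c Ku; first by rewrite /c; lia.
have [|v' vv' lv] := @chain_to_level s v c Kv; first by rewrite /c; lia.
have Ku' := chain_end uu'; have Kv' := chain_end vv'.
suff [z u'z v'z] : exists2 z, chain K s u' z & chain K s v' z.
  by exists z; [exact: chain_trans uu' u'z|exact: chain_trans vv' v'z].
have diag (a b : Z2) : level s a = level s b -> 0 <= sg s * (a.1 - b.1) ->
    a = (b.1 + sg s * Posz `|a.1 - b.1|, b.2 + sg s * Posz `|a.1 - b.1|).
  by rewrite /level; clear; case: a b => [i j] [k l]; case: s => /= *; congr (_, _); lia.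
(* The point further along the diagonal must be the walker that prefers horizontal steps. *)
have [d0|d0] := leP 0 (sg s * (u'.1 - v'.1)).
  have [T] := typical_meet Gtyp s v' `|u'.1 - v'.1|%N.
  by rewrite -diag ?lu ?lv//; exact: merge_of_meeting.
have [T] := typical_meet Gtyp s u' `|v'.1 - u'.1|%N.
rewrite -diag ?lu ?lv//; last by move: d0; clear; case: s => /=; lia.
by move=> /(merge_of_meeting Kv' Ku') [z]; exists z.
Qed.

(** At a site whose horizontal step is closed the vertical one is open, so one climbs column [i]
    inside [K] and turns off at [w] at the latest. *)
Lemma climb s i j w : K (i, j) -> les s j w -> hor_open s (G (i, w)) ->
  exists l, [/\ les s j l, les s l w & K (i - sg s, l)].
Proof.
have [n] := ubnP `|w - j|%N; elim: n j => // n IH j jn Kj jw hw.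
have [hj|nhj] := pselect (hor_open s (G (i, j))).
  by exists j; split=> //; [exact: les_refl|exact: Khor Kj hj].
have [//|vj] := typical_open Gtyp s (i, j).
have njw : j <> w by move=> jw'; apply: nhj; rewrite jw'.
have [|||l [jl lw Kl]] := IH (j + sg s) _ (Kver Kj vj) => //.
- by case: s jw {hw IH nhj vj} => /=; lia.
- by case: s jw {hw IH nhj vj} => /=; lia.
by exists l; split=> //; case: s jl {hw IH nhj vj jw lw Kl} => /=; lia.
Qed.

Lemma typical_col s p : K p -> exists2 j, les s p.2 j & K (p.1 - sg s, j).
Proof.
case: p => i j Kp; have [w jw hw] := typical_unbounded Gtyp s (~~ s) i j.
rewrite lesN in jw; have [l [jl _ Kl]] := climb Kp jw hw; by exists l.
Qed.

Lemma typical_col_unbounded s i : (forall h, exists2 j, les s j h & K (i, j)) ->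
  forall h, exists2 j, les s j h & K (i - sg s, j).
Proof.
move=> unb h; have [w wh hw] := typical_unbounded Gtyp s s i h.
have [j jw Kj] := unb w; have [l [_ lw Kl]] := climb Kj jw hw.
by exists l => //; exact: les_trans lw wh.
Qed.

End TypicalEnvironment.

(** * Mixing of the shift *)

Definition shift (t : Z2) (G : env) : env := fun z => G (z + t).

Lemma shift_rect t s B :
  shift t @^-1` rect s B = rect [seq z + t | z <- s] (fun z => B (z - t)).
Proof.
apply/seteqP; split=> G; rewrite /rect /shift /=.
  by move=> h _ /mapP[z zs ->]; rewrite addrK; exact: h.
by move=> h z zs; have := h _ (map_f (fun z => z + t) zs); rewrite addrK.
Qed.

Lemma sigma_on_shift t S E : sigma_on S E ->
  sigma_on [set z | S (z - t)] (shift t @^-1` E).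
Proof.
move: E; suff H : sigma_on S `<=`
    image_set_system setT (shift t) (sigma_on [set z | S (z - t)]).
  by move=> E /H; rewrite /image_set_system /= setTI.
apply: smallest_sub; first by apply: sigma_algebra_image; exact: smallest_sigma_algebra.
move=> _ [s [B [sS ->]]]; rewrite /image_set_system /= setTI shift_rect.
apply: sub_sigma_algebra; exists [seq z + t | z <- s], (fun z => B (z - t)).
by split=> // _ /mapP[z /sS Sz ->]; rewrite /= addrK.
Qed.

Lemma measurable_shift_preimage t E : measurable E -> measurable (shift t @^-1` E).
Proof.
by move=> mE; apply: sigma_on_measurable (sigma_on_shift (measurable_sigma_on mE)).
Qed.

Lemma measurable_shift t : measurable_fun [set: env] (shift t).
Proof. by move=> _ E mE; rewrite setTI; exact: measurable_shift_preimage. Qed.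

(** Allows the image of [nu] under the shift to be written [distribution nu (shift t)]. *)
HB.instance Definition _ t :=
  isMeasurableFun.Build _ _ env env (shift t) (measurable_shift t).

Section Mixing.
Context (R : realType) (mu : probability powE R) (nu : probability env R).
Hypothesis nu_prod : is_product_measure mu nu.

(** The image measure agrees with [nu] on the pi-system of rectangles. *)
Lemma nu_shift t E : measurable E -> nu (shift t @^-1` E) = nu E.
Proof.
move=> mE.
apply: (@g_sigma_algebra_measure_unique _ _ _ (rects setT) _ (fun=> setT) _ _
  (distribution nu (shift t)) nu) (measurable_sigma_on mE).
- by move=> A rA; apply: (@sigma_on_measurable setT); exact: sub_sigma_algebra.
- by move=> _; exact: rects_setT.
- by apply/seteqP; split=> // G _; exists 0%N.
- exact: rects_setI.
- move=> _ [s [B [_ ->]]].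
  transitivity (nu (shift t @^-1` rect s B)); first by [].
  rewrite shift_rect (nu_rect nu_prod) undup_map_inj; last exact: addIr.
  rewrite big_map; transitivity (\prod_(z <- undup s) mu (B z))%E.
    by apply: eq_bigr => z _; rewrite addrK.
  by rewrite -(nu_rect nu_prod).
- by move=> _; apply: (@le_lt_trans _ _ 1%E); [exact: probability_le1|exact: ltry].
Qed.

Lemma pr_shift t E : measurable E -> pr nu (shift t @^-1` E) = pr nu E.
Proof. by move=> mE; rewrite /pr nu_shift. Qed.

(** Horizontally infinite strips are enough, because mixing is needed for vertical shifts only. *)
Definition strip (m : nat) : set Z2 := [set z | (`|z.2| <= m)%N].

Lemma strip_mono m n : (m <= n)%N -> strip m `<=` strip n.
Proof. by move=> mn z /leq_trans; apply. Qed.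

Definition approximable (E : set env) := measurable E /\ forall e : R, 0 < e ->
  exists m C, sigma_on (strip m) C /\ pr nu (E `\` C) + pr nu (C `\` E) <= e.

Lemma pr_triangle A B C : measurable A -> measurable B -> measurable C ->
  pr nu (A `\` C) <= pr nu (A `\` B) + pr nu (B `\` C).
Proof.
move=> mA mB mC; have mD X Y : measurable X -> measurable Y -> measurable (X `\` Y : set env).
  by move=> mX mY; exact: measurableD.
apply: le_trans (pr_subadd _ (mD _ _ mA mB) (mD _ _ mB mC)).
apply: le_pr; [exact: mD|by apply: measurableU; exact: mD|].
by move=> G [AG nC]; have [BG|nB] := pselect (B G); [right|left].
Qed.

Lemma approximable0 : approximable set0.
Proof.
split=> // e e0; exists 0%N, set0; split; first exact: sigma_on0.
by rewrite setD0 pr0 addr0 ltW.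
Qed.

Lemma approximableC E : approximable E -> approximable (~` E).
Proof.
move=> [mE aE]; split=> [|e /aE [m [C [SC h]]]]; first exact: measurableC.
exists m, (~` C); split; first exact: sigma_onC.
by rewrite !setDE !setCK setIC -setDE (setIC _ E) -setDE addrC.
Qed.

Lemma approximableU E F : approximable E -> approximable F -> approximable (E `|` F).
Proof.
move=> [mE aE] [mF aF]; split=> [|e e0]; first exact: measurableU.
have e2 : 0 < e / 2 by rewrite divr_gt0.
have [m [C [SC hC]]] := aE _ e2; have [n [D [SD hD]]] := aF _ e2.
exists (maxn m n), (C `|` D); split.
  by apply: sigma_onU; [apply: sub_sigma_on SC|apply: sub_sigma_on SD];
     apply: strip_mono; rewrite ?leq_maxl ?leq_maxr.
have mC := sigma_on_measurable SC; have mD := sigma_on_measurable SD.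
have sub (A B A' B' : set env) : measurable A -> measurable B -> measurable A' -> measurable B' ->
    pr nu ((A `|` A') `\` (B `|` B')) <= pr nu (A `\` B) + pr nu (A' `\` B').
  move=> mA mB mA' mB'; have mAB : measurable (A `\` B) by exact: measurableD.
  have mAB' : measurable (A' `\` B') by exact: measurableD.
  apply: le_trans (pr_subadd _ mAB mAB'); apply: le_pr.
  - by apply: measurableD; exact: measurableU.
  - exact: measurableU.
  - by move=> G [[AG|AG] nB]; [left|right]; split=> // BG; apply: nB; [left|right].
have := sub E C F D mE mC mF mD; have := sub C E D F mC mE mD mF.
lra.
Qed.

Lemma approximable_bigcup (E : (set env)^nat) :
  (forall n, approximable (E n)) -> approximable (\bigcup_n E n).
Proof.
move=> aE; have mE n : measurable (E n) by have [] := aE n.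
have mU : measurable (\bigcup_n E n) by exact: bigcupT_measurable.
split=> // e e0; have e2 : 0 < e / 2 by rewrite divr_gt0.
pose U n := \big[setU/set0]_(i < n) E i.
have aU n : approximable (U n).
  rewrite /U; elim: n => [|n IH]; first by rewrite big_ord0; exact: approximable0.
  by rewrite big_ord_recr /=; apply: approximableU.
have mUn n : measurable (U n) by have [] := aU n.
(* Continuity from above: finite unions exhaust the countable one up to [e / 2], and the other half
   is left for approximating [U n]. *)
have [n Hn] : exists n, pr nu (\bigcup_n E n `\` U n) <= e / 2.
  have : nu \o (fun n => \bigcup_n E n `\` U n) @ \oo --> nu (\bigcap_n (\bigcup_n E n `\` U n)).
    apply: nonincreasing_cvg_mu.
    - by rewrite (le_lt_trans (probability_le1 _ _)) ?ltry//; exact: measurableD.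
    - by move=> n; exact: measurableD.
    - by apply: bigcapT_measurable => n; exact: measurableD.
    - move=> m n mn; apply/subsetPset; apply: setDS; exact: subset_bigsetU.
  rewrite (_ : \bigcap_n _ = set0); last first.
    apply/seteqP; split=> // G h; have [[n _ EG] _] := h 0%N I.
    by have [_] := h n.+1 I; apply; rewrite /U big_ord_recr /=; right.
  rewrite measure0 => /fine_cvgP[_ /cvgrPdist_le /(_ _ e2) [n _ /(_ n (leqnn n))]].
  rewrite sub0r normrN => h; exists n; apply: le_trans h; exact: ler_norm.
have [m [C [SC hC]]] := (aU n).2 _ e2; exists m, C; split=> //.
have mC := sigma_on_measurable SC.
have h1 := pr_triangle mU (mUn n) mC.
have h2 : pr nu (C `\` \bigcup_n E n) <= pr nu (C `\` U n).
  apply: le_pr; [exact: measurableD|exact: measurableD|apply: setDS].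
  by rewrite /U => G; rewrite -bigcup_mkord => -[i _ Ei]; exists i.
lra.
Qed.

(** Approximable events form a sigma-algebra containing the one-site cylinders. *)
Lemma measurable_approximable E : measurable E -> approximable E.
Proof.
move: E; apply: smallest_sub.
  split; first exact: approximable0.
  - by move=> A aA; rewrite setTD; exact: approximableC.
  - exact: approximable_bigcup.
move=> _ [z _ [B _ <-]]; split=> [|e e0]; first exact: measurable_site.
exists `|z.2|%N, [set G | B (G z)]; split; first by apply: sigma_on_site; exact: leqnn.
by rewrite setDv pr0 addr0 ltW.
Qed.

Lemma mixing E F : measurable E -> measurable F -> 0 < pr nu E -> 0 < pr nu F ->
  exists n : nat, 0 < pr nu (E `&` shift (0, - Posz n) @^-1` F).
Proof.
move=> mE mF E0 F0; have E1 := pr_le1 nu mE; have F1 := pr_le1 nu mF.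
(* Replacing [E] and [F] by [C] and [D] and back costs at most [4 * e + e ^ 2], which is less than
   [8 * e]. *)
pose e := pr nu E * pr nu F / 8.
have EF0 : 0 < pr nu E * pr nu F by rewrite mulr_gt0.
have e0 : 0 < e by rewrite divr_gt0.
have [m [C [SC hC]]] := (measurable_approximable mE).2 _ e0.
have [k [D [SD hD]]] := (measurable_approximable mF).2 _ e0.
have mC := sigma_on_measurable SC; have mD := sigma_on_measurable SD.
(* The strip of [D] is moved to heights at most [- m - 1], off the strip of [C]. *)
pose t : Z2 := (0, - Posz (m + k).+1); exists (m + k).+1; rewrite -/t.
have SD' := @sigma_on_shift t _ _ SD.
have mF' := measurable_shift_preimage t mF; have mD' := measurable_shift_preimage t mD.
have CD : pr nu (C `&` shift t @^-1` D) = pr nu C * pr nu D.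
  rewrite -(pr_shift t mD); apply: (pr_indep nu_prod _ SC SD').
  by apply/seteqP; split=> // -[i j] []; rewrite /strip /t /=; lia.
have mCE : measurable (C `\` E) by exact: measurableD.
have mEC : measurable (E `\` C) by exact: measurableD.
have mDF : measurable (D `\` F) by exact: measurableD.
have DF : pr nu (shift t @^-1` D `\` shift t @^-1` F) = pr nu (D `\` F).
  exact: (pr_shift t mDF).
have mFD : measurable (F `\` D) by exact: measurableD.
have mDF' := measurable_shift_preimage t mDF.
have mEF' : measurable (E `&` shift t @^-1` F) by exact: measurableI.
have h1 : pr nu (C `&` shift t @^-1` D) <=
    pr nu (E `&` shift t @^-1` F) + (pr nu (C `\` E) + pr nu (D `\` F)).
  rewrite -DF; apply: le_trans (_ : _ <= pr nu ((E `&` shift t @^-1` F) `|`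
    ((C `\` E) `|` (shift t @^-1` D `\` shift t @^-1` F)))) _.
    apply: le_pr; [exact: measurableI|by do 2! apply: measurableU => //|].
    move=> G [CG DG]; have [EG|nE] := pselect (E G); last by right; left.
    by have [FG|nF] := pselect ((shift t @^-1` F) G); [left|right; right].
  apply: le_trans (pr_subadd _ mEF' (measurableU _ _ mCE mDF')) _.
  by rewrite lerD2l; exact: pr_subadd.
have h2 : pr nu E <= pr nu C + pr nu (E `\` C).
  apply: le_trans (pr_subadd _ mC mEC); apply: le_pr => //; first exact: measurableU.
  by move=> G EG; have [|] := pselect (C G); [left|right].
have h3 : pr nu F <= pr nu D + pr nu (F `\` D).
  apply: le_trans (pr_subadd _ mD mFD); apply: le_pr => //; first exact: measurableU.
  by move=> G EG; have [|] := pselect (D G); [left|right].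
have := pr_ge0 nu (C `\` E); have := pr_ge0 nu (D `\` F).
have := pr_ge0 nu (E `\` C); have := pr_ge0 nu (F `\` D).
have := pr_ge0 nu C; have := pr_ge0 nu D.
have C1 := pr_le1 nu mC; have D1 := pr_le1 nu mD.
rewrite CD in h1; have : e * 8 = pr nu E * pr nu F by rewrite /e divfK.
nra.
Qed.

End Mixing.

(** * Backward clusters *)

Lemma reachesP G u v : reaches G u v <-> exists n, reaches_in n u v G.
Proof.
by have /(congr1 (fun A => A G)) /= := reaches_inE u v => ->.
Qed.

Lemma reaches_step G u w v : vec (G u) (w - u) -> reaches G w v -> reaches G u v.
Proof. by move=> uw /reachesP[n wv]; apply/reachesP; exists n.+1, w. Qed.

Lemma reaches_refl G u : reaches G u u.
Proof. by apply/reachesP; exists 0%N. Qed.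

Lemma vec_steps A e : vec A e -> e \in steps.
Proof. by move=> [f _ <-]; exact: ssvalP. Qed.

Lemma adj_step (u w : Z2) : w - u \in steps -> adj w u.
Proof.
rewrite !inE => /or4P[] /eqP wu; have -> : u = w - (w - u) by rewrite subKr.
all: rewrite wu /adj.
- by exists true; left; case: w {wu} => i j; congr (_, _); rewrite /=; lia.
- by exists false; right; case: w {wu} => i j; congr (_, _); rewrite /=; lia.
- by exists false; left; case: w {wu} => i j; congr (_, _); rewrite /=; lia.
- by exists true; right; case: w {wu} => i j; congr (_, _); rewrite /=; lia.
Qed.

(** Every point of an open path to [x] itself lies in [Bset G x]. *)
Lemma Bset_connected G x : connected_from x (Bset G x).
Proof.
move=> P Px Pstep b /reachesP[n]; elim: n b => [b -> //|n IH b [z [bz zx]]].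
have Bz : Bset G x z by apply/reachesP; exists n.
apply: (Pstep z) => //; first exact: IH.
- exact: reaches_step bz Bz.
- exact: adj_step (vec_steps bz).
Qed.

Lemma hor_unreached G x s p :
  ~ Bset G x p -> hor_open s (G p) -> ~ Bset G x (hor s p).
Proof.
move=> nB hp Bh; apply: nB; apply: reaches_step Bh.
suff -> : hor s p - p = (- sg s, 0) by [].
by case: p {hp} => i j; congr (_, _) => /=; lia.
Qed.

Lemma ver_unreached G x s p :
  ~ Bset G x p -> ver_open s (G p) -> ~ Bset G x (ver s p).
Proof.
move=> nB hp Bh; apply: nB; apply: reaches_step Bh.
suff -> : ver s p - p = (0, sg s) by [].
by case: p {hp} => i j; congr (_, _) => /=; lia.
Qed.

(** Blocking is automatic: an open path from above [W] into [Bset G x] would put its starting point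
    in [Bset G x]. *)
Lemma upper_eventI G x W : decreasingZ W -> Bset G x = region_le W -> upper_event x G.
Proof.
move=> Wd BW; exists W; split=> // y z gy lz yz.
have : Bset G x y by apply: reaches_trans yz _; change (Bset G x z); rewrite BW.
by rewrite BW /region_le /= leNgt; rewrite /region_gt /= in gy; rewrite gy.
Qed.

Lemma lower_eventI G x W : decreasingZ W -> Bset G x = region_ge W -> lower_event x G.
Proof.
move=> Wd BW; exists W; split=> // y z gy lz yz.
have : Bset G x y by apply: reaches_trans yz _; change (Bset G x z); rewrite BW.
by rewrite BW /region_ge /= leNgt; rewrite /region_lt /= in gy; rewrite gy.
Qed.

Lemma typical_tetrachotomy G x : typical G ->
  [\/ finite_event x G, full_event x G, upper_event x G | lower_event x G].
Proof.
move=> Gt; have Kh s p := @hor_unreached G x s p; have Kv s p := @ver_unreached G x s p.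
have nK : ~ (~` Bset G x) x by apply; exact: reaches_refl.
have Bc : connected_from x (~` ~` Bset G x) by rewrite setCK; exact: Bset_connected.
have := tetrachotomy nK Bc (typical_stepping Gt Kh Kv)
  (typical_col Gt Kh Kv) (typical_col_unbounded Gt Kh Kv) (typical_merge Gt Kh Kv).
rewrite setCK => -[fin|full|[W [Wd BW]]|[W [Wd BW]]].
- exact: Or41.
- exact: Or42.
- by apply: Or43; exact: upper_eventI BW.
- by apply: Or44; exact: lower_eventI BW.
Qed.

Lemma reaches_shift t G u v : reaches (shift t G) u v -> reaches G (u + t) (v + t).
Proof.
move=> [n [p [<- <- op]]]; exists n, (fun i => p i + t); split=> // i /op.
by rewrite /shift opprD addrACA subrr addr0.
Qed.

Lemma shiftK t : cancel (shift t) (shift (- t)).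
Proof. by move=> G; apply/funext => z; rewrite /shift subrK. Qed.

Lemma Bset_shift t G x : Bset (shift t G) x = [set w | Bset G (x + t) (w + t)].
Proof.
apply/seteqP; split=> w /=; first exact: reaches_shift.
by rewrite /Bset /= -{1}(shiftK t G) => /reaches_shift; rewrite !addrK.
Qed.

Lemma Bset_unshift t G x : Bset G (x + t) = [set w | Bset (shift t G) x (w - t)].
Proof. by apply/seteqP; split=> w; rewrite /= Bset_shift /= subrK. Qed.

Lemma full_event_shift t G x : full_event x (shift t G) -> full_event (x + t) G.
Proof. by rewrite /full_event /= Bset_unshift => ->. Qed.

Lemma lower_event_shift t G x : lower_event x (shift t G) -> lower_event (x + t) G.
Proof.
move=> [W [Wd _ BW]]; apply: (@lower_eventI _ _ (fun i => W (i - t.1) + t.2)).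
  by move=> i; rewrite lerD2r addrAC.
rewrite Bset_unshift BW; apply/seteqP; split=> -[i j] /=.
  by change (W (i - t.1) <= j - t.2 -> W (i - t.1) + t.2 <= j); rewrite lerBrDr.
by change (W (i - t.1) + t.2 <= j -> W (i - t.1) <= j - t.2); rewrite lerBrDr.
Qed.

Lemma infinite_half_column (A : set Z2) i m s :
  (forall n : nat, A (i, m + sg s * Posz n)) -> infinite_set A.
Proof.
move=> hA; pose f (n : nat) : Z2 := (i, m + sg s * Posz n).
apply: (@sub_infinite_set _ (range f)); first by move=> _ [n _ <-]; exact: hA.
have fI : injective f by move=> k l []; case: s {hA f} => /=; lia.
by apply/infiniteP; rewrite (card_le_eqr (inj_card_eq (in2W fI))).
Qed.

(** * Incompatibility of the infinite cases *)

Section Coexistence.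
Context (R : realType) (mu : probability powE R) (nu : probability env R).
Hypothesis nu_prod : is_product_measure mu nu.

Lemma measure_gt0_pr E : measurable E -> (0 < nu E)%E = (0 < pr nu E).
Proof. by move=> mE; rewrite (prE nu mE) lte_fin. Qed.

(** If both probabilities were positive, mixing would realise [A] at [x] and [B] at some
    [x - (0, n)] in the same environment. *)
Lemma coexist (A B : Z2 -> set env) x : measurable (A x) -> measurable (B x) ->
  (forall t G, B x (shift t G) -> B (x + t) G) ->
  (forall (n : nat) G, A x G -> B (x + (0, - Posz n)) G -> False) ->
  ~ ((0 < nu (A x))%E /\ (0 < nu (B x))%E).
Proof.
move=> mA mB Bsh AB []; rewrite !measure_gt0_pr// => A0 B0.
have [n] := mixing nu_prod mA mB A0 B0; rewrite (_ : _ `&` _ = set0) ?pr0 ?ltxx//.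
by apply/seteqP; split=> // G [AG /Bsh]; exact: AB AG.
Qed.

(** The upper event is taken at [x]: then [x - (0, n)], lying below [x], reaches [x], and so does
    every point that reaches [x - (0, n)]. *)
Lemma no_full_upper x : ~ ((0 < nu (full_event x))%E /\ (0 < nu (upper_event x))%E).
Proof.
move=> [f0 u0]; have [] := coexist (measurable_upper_event x) (measurable_full_event x) _ _ (conj u0 f0).
- by move=> t G; exact: full_event_shift.
move=> n G [W [_ _ BW]] full.
have Bx : Bset G x x by exact: reaches_refl.
have By : Bset G x (x + (0, - Posz n)).
  by move: Bx; rewrite BW /region_le /= addr0; lia.
have : Bset G x (x.1, W x.1 + 1).
  by apply: reaches_trans By; change (Bset G (x + (0, - Posz n)) (x.1, W x.1 + 1)); rewrite full.
by rewrite BW /region_le /=; lia.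
Qed.

(** The lower event is taken at [x - (0, n)], which [x] then reaches from above; every point reaches
    [x]. *)
Lemma no_full_lower x : ~ ((0 < nu (full_event x))%E /\ (0 < nu (lower_event x))%E).
Proof.
apply: coexist (measurable_full_event x) (measurable_lower_event x) _ _.
  by move=> t G; exact: lower_event_shift.
move=> n G full [W [_ _ BW]].
have By : Bset G (x + (0, - Posz n)) (x + (0, - Posz n)) by exact: reaches_refl.
have Bx : Bset G (x + (0, - Posz n)) x.
  by move: By; rewrite BW /region_ge /= addr0; lia.
have : Bset G (x + (0, - Posz n)) (x.1, W x.1 - 1).
  by apply: reaches_trans Bx; change (Bset G x (x.1, W x.1 - 1)); rewrite full.
by rewrite BW /region_ge /=; lia.
Qed.

(** A point high above [x] reaches [x - (0, n)] and from there [x], although it lies above [W]. *)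
Lemma no_upper_lower x : ~ ((0 < nu (upper_event x))%E /\ (0 < nu (lower_event x))%E).
Proof.
apply: coexist (measurable_upper_event x) (measurable_lower_event x) _ _.
  by move=> t G; exact: lower_event_shift.
move=> n G [W [_ _ BW]] [V [_ _ BV]].
have Bx : Bset G x x by exact: reaches_refl.
have By : Bset G x (x + (0, - Posz n)).
  by move: Bx; rewrite BW /region_le /= addr0; lia.
pose j := Order.max (V x.1) (W x.1 + 1).
have : Bset G x (x.1, j).
  apply: reaches_trans By; change (Bset G (x + (0, - Posz n)) (x.1, j)).
  by rewrite BV /region_ge /j /=; lia.
by rewrite BW /region_le /j /=; lia.
Qed.

Lemma ae_no_upper_lower : {ae nu, forall G, forall y z, ~ (upper_event y G /\ lower_event z G)}.
Proof.
apply: ae_countable => y; apply: ae_countable => z.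
have mU := measurable_upper_event y; have mL := measurable_lower_event z.
have [u0|] := ltP 0%E (nu (upper_event y)); last first.
  rewrite le_eqVlt ltNge measure_ge0 orbF => /eqP u0.
  have : nu.-negligible (upper_event y) by apply/negligibleP.
  by apply: negligibleS => G /contrapT[].
have [l0|] := ltP 0%E (nu (lower_event z)); last first.
  rewrite le_eqVlt ltNge measure_ge0 orbF => /eqP l0.
  have : nu.-negligible (lower_event z) by apply/negligibleP.
  by apply: negligibleS => G /contrapT[].
have [] := @no_upper_lower y; split=> //; apply: lt_le_trans l0 _.
(* Translation by [y - z] carries the lower event from [z] to [y], where [no_upper_lower]
   applies. *)
rewrite -(nu_shift nu_prod (y - z) mL).
apply: le_measure; rewrite ?inE; first exact: measurable_shift_preimage.
  exact: measurable_lower_event.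
by move=> G; rewrite /preimage /= => /lower_event_shift; rewrite addrC subrK.
Qed.

End Coexistence.

(** Two infinite clusters of the same kind share a half-column, here in column 0; a full cluster
    contains the other one. *)
Lemma infinite_meet G y z : typical G ->
  (forall y z, ~ (upper_event y G /\ lower_event z G)) ->
  infinite_set (Bset G y) -> infinite_set (Bset G z) ->
  infinite_set (Bset G y `&` Bset G z).
Proof.
move=> Gt nul yinf zinf.
have [//|By|[W [Wd _ By]]|[W [Wd _ By]]] := typical_tetrachotomy y Gt.
- by rewrite [Bset G y]By setTI.
- have [//|Bz|[V [_ _ Bz]]|lz] := typical_tetrachotomy z Gt.
  + by rewrite [Bset G z]Bz setIT.
  + rewrite By Bz; apply: (@infinite_half_column _ 0 (Order.min (W 0) (V 0)) false) => n.
    by rewrite /region_le /=; lia.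
  + by case: (nul y z); split=> //; exact: upper_eventI Wd By.
- have [//|Bz|uz|[V [_ _ Bz]]] := typical_tetrachotomy z Gt.
  + by rewrite [Bset G z]Bz setIT.
  + by case: (nul z y); split=> //; exact: lower_eventI Wd By.
  + rewrite By Bz; apply: (@infinite_half_column _ 0 (Order.max (W 0) (V 0)) true) => n.
    by rewrite /region_ge /=; lia.
Qed.

Theorem proposition3p8 (R : realType) (mu : probability powE R)
    (nu : probability env R) (nu_prod : is_product_measure mu nu)
    (mu_pos : forall e, e \in steps ->
       (0 < mu [set A | vec A e])%E)
    (mu_NW : mu [set A | vec A `&` [set e2; - e1] !=set0] = 1%E)
    (mu_SE : mu [set A | vec A `&` [set - e2; e1] !=set0] = 1%E)
    (x : Z2) :
  [/\ {ae nu, forall G, [\/ finite_event x G, full_event x G,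
                           upper_event x G | lower_event x G]},
      [/\ ~ ((0 < nu (full_event x))%E /\ (0 < nu (upper_event x))%E),
          ~ ((0 < nu (full_event x))%E /\ (0 < nu (lower_event x))%E)
        & ~ ((0 < nu (upper_event x))%E /\ (0 < nu (lower_event x))%E)]
    & {ae nu, forall G, forall y z : Z2,
         infinite_set (Bset G y) -> infinite_set (Bset G z) ->
         infinite_set (Bset G y `&` Bset G z)}].
Proof.
have typ : {ae nu, forall G, typical G}.
  apply: (ae_typical nu_prod).
  - by case; apply: mu_pos.
  - by case; apply: mu_pos.
  (* The directions are [- e1] and [e2] for [s = true], covered by [mu_NW], and [e1] and [- e2] for
     [s = false], covered by [mu_SE]. *)
  - case.
      rewrite -mu_NW; congr (mu _); apply/seteqP; split=> A.
        by move=> [hA|vA]; [exists (- e1)|exists e2]; split=> //; [right|left].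
      by move=> [e [Ae [eE|eE]]]; rewrite eE in Ae; [right|left].
    rewrite -mu_SE; congr (mu _); apply/seteqP; split=> A.
      by move=> [hA|vA]; [exists e1|exists (- e2)]; split=> //; [right|left].
    by move=> [e [Ae [eE|eE]]]; rewrite eE in Ae; [right|left].
split; first by apply: filterS typ => G; exact: typical_tetrachotomy.
- split; [exact: (no_full_upper nu_prod)|exact: (no_full_lower nu_prod)|].
  exact: (no_upper_lower nu_prod).
- have nul := ae_no_upper_lower nu_prod.
  by apply: filterS2 typ nul => G Gt nul y z; exact: infinite_meet.
Qed.
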